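(* Let $R_0>0$, let $u_0\in L^1(0,\infty)$ be supported in $[0,R_0]$, and let $M=\int_0^\infty u_0(x)\,dx$. Let $u^L$ and $u^\infty$ be the Hopf--Cole solutions on $(0,L)$ and $(0,\infty)$ of the viscous Burgers problem with conservative boundary conditions and datum $u_0$ (see context), and set $v^L(\xi,t)=\sqrt t\,u^L(\xi\sqrt t,t)$, $v^\infty(\xi,t)=\sqrt t\,u^\infty(\xi\sqrt t,t)$. Fix $R>0$, an integer $k\ge0$ and $\varepsilon\in(0,1)$, and let $t=cL^2$ with $0<c<1/R^2$. Then there exist $C_k=C_k(\|u_0\|_{L^1},R_0,R,k,\varepsilon)>0$, independent of $c$ and $L$, and $L_0=L_0(R_0,R,\varepsilon)$ such that $$\|v^L(\cdot,t)-v^\infty(\cdot,t)\|_{C^k([0,R])}\le C_k\,e^{-(1-\varepsilon)/c},\qquad L\ge L_0.$$ If $M\ne0$, the exponential constant $1$ is optimal in the following uniform sense: no estimate of this form (with constants independent of $c$ and $L$) can hold with $1-\varepsilon$ replaced by a fixed number larger than $1$.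
   Context: Set $w_0(x)=\exp\left(\int_0^x u_0(z)\,dz\right)$. Interval problem ($L\ge R_0$): $u_t-u_{xx}=(u^2)_x$ in $(0,L)\times(0,\infty)$, $u_x=-u^2$ at $x=0$ and at $x=L$, $u(\cdot,0)=u_0$. Its Hopf--Cole solution is $u^L=w^L_x/w^L$, where $w^L>0$ is the classical solution (continuous up to $t=0$) of $w_t=w_{xx}$ in $(0,L)\times(0,\infty)$, $w(0,t)=1$, $w(L,t)=e^M$, $w(\cdot,0)=w_0$. Half-line problem: $u_t-u_{xx}=(u^2)_x$ in $(0,\infty)\times(0,\infty)$, $u_x(0,t)=-u^2(0,t)$, $u(\cdot,0)=u_0$. Its Hopf--Cole solution is $u^\infty=w^\infty_x/w^\infty$, where $w^\infty>0$ is the bounded classical solution of $w_t=w_{xx}$ in $(0,\infty)\times(0,\infty)$, $w(0,t)=1$, $w(\cdot,0)=w_0$. *)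

(* Defs.v *)
From HB Require Import structures.
From mathcomp Require Import all_boot all_order all_algebra.
From mathcomp Require Import all_classical all_reals all_analysis.

Set Implicit Arguments.
Unset Strict Implicit.
Unset Printing Implicit Defensive.

Import Order.TTheory GRing.Theory Num.Theory.
Import numFieldNormedType.Exports.

Local Open Scope classical_set_scope.
Local Open Scope ring_scope.

(* Functions of space and time are total curried functions [w x t]; values
   outside the space-time domain under consideration are never used. *)

Section Datum.
Context {R : realType}.
Implicit Types x : R.

(* Support is understood almost everywhere, as for a class in L^1(0,oo). *)
Definition L1_datum (R0 : R) (u0 : R -> R) : Prop :=
  (@lebesgue_measure R).-integrable `]0, +oo[ (EFin \o u0) /\
  {ae @lebesgue_measure R, forall x, R0 < x -> u0 x = 0}.

Definition L1_norm (u0 : R -> R) : R := \int[lebesgue_measure]_(x in `]0, +oo[) `|u0 x|.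

Definition mass (u0 : R -> R) : R := \int[lebesgue_measure]_(x in `]0, +oo[) u0 x.

Definition hopf_cole_datum (u0 : R -> R) x : R :=
  expR (\int[lebesgue_measure]_(z in `]0, x]) u0 z).

End Datum.

Section HeatEquation.
Context {R : realType}.
Implicit Types (w u : R -> R -> R) (D : set R) (L x t : R).

Definition dx w : R -> R -> R := fun x t => derive1 (fun y => w y t) x.
Definition dt w : R -> R -> R := fun x t => derive1 (w x) t.

(* [w] is of class C^{2,1} (two space derivatives, one time derivative, all
   jointly continuous) on D x (0,oo), D open, and w_t = w_xx there. *)
Definition classical_heat D w : Prop :=
  forall x t, D x -> 0 < t ->
  [/\ [/\ derivable (w x) t 1,
          derivable (fun y => w y t) x 1 &
          derivable (fun y => dx w y t) x 1],
      [/\ {for (x, t), continuous (fun p : R * R => dt w p.1 p.2)},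
          {for (x, t), continuous (fun p : R * R => dx w p.1 p.2)} &
          {for (x, t), continuous (fun p : R * R => dx (dx w) p.1 p.2)}] &
      dt w x t = dx (dx w) x t].

Record heat_interval (u0 : R -> R) L w : Prop := HeatInterval {
  hi_classical : classical_heat `]0, L[ w;
  hi_continuous : {within `[0, L] `*` `[0, +oo[,
                     continuous (fun p : R * R => w p.1 p.2)};
  hi_pos : forall x t, 0 <= x <= L -> 0 <= t -> 0 < w x t;
  hi_left : forall t, 0 < t -> w 0 t = 1;
  hi_right : forall t, 0 < t -> w L t = expR (mass u0);
  hi_init : forall x, 0 <= x <= L -> w x 0 = hopf_cole_datum u0 x }.

Record heat_halfline (u0 : R -> R) w : Prop := HeatHalfline {
  hh_classical : classical_heat `]0, +oo[ w;
  hh_continuous : {within `[0, +oo[ `*` `[0, +oo[,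
                     continuous (fun p : R * R => w p.1 p.2)};
  hh_bounded : exists B : R, forall x t, 0 <= x -> 0 <= t -> `|w x t| <= B;
  hh_pos : forall x t, 0 <= x -> 0 <= t -> 0 < w x t;
  hh_left : forall t, 0 < t -> w 0 t = 1;
  hh_init : forall x, 0 <= x -> w x 0 = hopf_cole_datum u0 x }.

Definition hopf_cole w : R -> R -> R := fun x t => dx w x t / w x t.

Definition HC_interval (u0 : R -> R) L u : Prop :=
  exists2 w, heat_interval u0 L w & u = hopf_cole w.

Definition HC_halfline (u0 : R -> R) u : Prop :=
  exists2 w, heat_halfline u0 w & u = hopf_cole w.

(* v(xi, t) = sqrt t * u(xi * sqrt t, t), as a function of xi. *)
Definition rescaled u t : R -> R := fun xi => Num.sqrt t * u (xi * Num.sqrt t) t.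

End HeatEquation.

Section CkSpace.
Context {R : realType}.
Implicit Types (f : R -> R) (k : nat) (a : R).

(* C^k([0,a]): C^k on (0,a), every derivative of order <= k extending
   continuously to [0,a].  Only values of f on (0,a) matter, so that functions
   defined as interior derivatives (such as w_x / w) need no convention at the
   endpoints. *)
Definition in_Ck k a f : Prop :=
  (forall j, (j < k)%N -> {in `]0, a[, forall x, derivable (derive1n j f) x 1}) /\
  (forall j, (j <= k)%N ->
     exists2 g : R -> R, {within `[0, a], continuous g} &
                         {in `]0, a[, derive1n j f =1 g}).

(* For f in C^k([0,a]) the supremum over (0,a) equals the maximum over [0,a]
   of the extended derivative.  It is extended-real valued, hence +oo, not a
   default value, when a derivative is unbounded. *)
Definition Ck_norm k a f : \bar R :=
  (\sum_(j < k.+1) ereal_sup [set `|derive1n j f x|%:E | x in `]0%R, a[])%E.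

End CkSpace.

(* Main.v *)
Require Import Defs.
From HB Require Import structures.
From mathcomp Require Import all_boot all_order all_algebra.
From mathcomp Require Import all_classical all_reals all_analysis.
From mathcomp Require Import measurable_realfun.
From mathcomp Require Import zify ring lra.

(* By the maximum principle, [w^oo - 1] and [w^L - 1] are the convolutions of the Gaussian
   with two extensions of [w_0 - 1] to the whole line: the odd one, for [w^oo], and for
   [w^L] the one which is odd about 0 and symmetric about the point [(L, e^M - 1)].  These
   extensions agree on [|y| <= 2 L - R0].  In the variable [xi = x / sqrt t] the difference
   of the two solutions is therefore a convolution of the unit Gaussian with a function
   supported in [|eta| >= (2 - R0 / L) / sqrt c], and so are all its derivatives with the
   Gaussian replaced by a derivative; this gives the factor [exp (- (1 - eps) / c)], since
   [(2 / sqrt c)^2 / 4 = 1 / c].  As [w^L] and [w^oo] are bounded below by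
   [e^(- ||u_0||_1)], passing to the quotients [w_x / w] only costs constants.
   For optimality, let [L] tend to infinity with [c] fixed: the difference of the two
   extensions tends to [e^M - 1] times an odd step function that is at least 2 beyond
   [2 / sqrt c], so the difference of the solutions is at least a multiple of [exp (- 1 / c)];
   it is controlled by [v^L - v^oo], the logarithmic derivative of [w^L / w^oo]. *)

(** When [M] is not 0, the extension for [w^L] gains 2 (e^M - 1) over every period and is unbounded;
    this is why the convolution estimates are written for data of linear growth. In the variable xi
    the slope of the extended datum is of order sqrt c, so the hypothesis c < 1 / rho^2 acts twice:
    it keeps [0, rho sqrt t] inside [0, L), and it bounds the growth by a constant that depends on
    ||u_0|| and rho only. The loss eps is spent in four quarters: on the polynomial factor of the
    derivatives of the Gaussian, on integrability against linear growth, on R0 / L, and on the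
    displacement of the support by xi in [0, rho]. For optimality the danger is cancellation, since
    the difference of the data is odd; subtracting the values of the convolution at x1 and - x1
    turns the integrand into a nonnegative function. *)

Set Implicit Arguments.
Unset Strict Implicit.
Unset Printing Implicit Defensive.

Import Order.TTheory GRing.Theory Num.Theory.
Import numFieldNormedType.Exports.

Local Open Scope classical_set_scope.
Local Open Scope ring_scope.

(** * Changes of variables and limits under the Lebesgue integral *)

Section LebesgueIntegral.
Context {R : realType}.
Notation mu := (@lebesgue_measure R).
Implicit Types (f g : R -> R).

Lemma ge0_integral_oppr (f : R -> \bar R) :
  measurable_fun setT f -> (forall x, (0 <= f x)%E) ->
  (\int[mu]_x f (- x)%R = \int[mu]_x f x)%E.
Proof.
move=> mf f0.
rewrite [RHS](_ : _ = \int[pushforward mu (-%R : _ -> measurableTypeR R)]_x f x)%E; last first.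
  by apply: eq_measure_integral => A mA _; exact/esym/lebesgue_measureN.
by rewrite ge0_integral_pushforward.
Qed.

Lemma Rintegral_oppr f : continuous f ->
  \int[mu]_x f (- x) = \int[mu]_x f x.
Proof.
move=> cf; have mf : measurable_fun [set: R] (EFin \o f).
  by apply/measurable_EFinP; exact: continuous_measurable_fun.
rewrite /Rintegral; congr fine; rewrite [LHS]integralE [RHS]integralE.
congr (_ - _)%E.
- rewrite -[RHS]ge0_integral_oppr//; last exact: measurable_funepos mf.
  by apply: eq_integral => x _; rewrite !funeposE.
- rewrite -[RHS]ge0_integral_oppr//; last exact: measurable_funeneg mf.
  by apply: eq_integral => x _; rewrite !funenegE.
Qed.

Lemma is_derive_affine (s b x : R) : is_derive x 1 (fun y => s * y + b) s.
Proof.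
apply: is_derive_eq.
by rewrite addr0 /GRing.scale/= mulr1.
Qed.

Lemma ge0_integral_affine (s b : R) f : 0 < s -> continuous f ->
  (forall x, 0 <= f x) ->
  (\int[mu]_x (f x)%:E = \int[mu]_x (f (s * x + b) * s)%:E)%E.
Proof.
move=> s0 cf f0.
have ds : (fun x : R => s * x + b)^`()%classic = cst s.
  apply/funext => x; rewrite derive1E; apply: derive_val.
  exact: is_derive_affine.
rewrite (@increasing_ge0_integration_by_substitutionT _ (fun x => s * x + b) f)//.
- by apply: eq_integral => x _; rewrite ds.
- by move=> x y xy; rewrite ltrD2r ltr_pM2l.
- by rewrite ds; exact: cst_continuous.
- by rewrite ds; exact: is_cvg_cst.
- by rewrite ds; exact: is_cvg_cst.
- apply/cvgrNyPle => A; near=> x.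
  rewrite -lerBrDr -ler_pdivlMl//; near: x; exact: nbhs_ninfty_le.
- apply/cvgryPge => A; near=> x.
  rewrite -lerBlDr -ler_pdivrMl//; near: x; exact: nbhs_pinfty_ge.
Unshelve.
all: end_near.
Qed.

Lemma continuous_maxr f g : continuous f -> continuous g ->
  continuous (fun x => Num.max (f x) (g x)).
Proof. by move=> cf cg x; apply: continuous_max; [exact: cf|exact: cg]. Qed.

(** The positive and negative parts are transformed separately in the extended reals, so the two
    real integrals are [fine] of the same value, whether or not [f] is integrable. *)
Lemma Rintegral_affine (s b : R) f : 0 < s -> continuous f ->
  \int[mu]_x f x = \int[mu]_x (f (s * x + b) * s).
Proof.
move=> s0 cf; rewrite /Rintegral; congr fine.
rewrite [LHS]integralE [RHS]integralE; congr (_ - _)%E.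
- transitivity (\int[mu]_x (Num.max (f x) 0)%:E)%E.
    by apply: eq_integral => x _; rewrite funeposE/= -EFin_max.
  rewrite (ge0_integral_affine b s0); last 2 first.
  + by apply: continuous_maxr => // x; exact: cst_continuous.
  + by move=> x; rewrite le_max lexx orbT.
  by apply: eq_integral => x _; rewrite funeposE/= -EFin_max maxr_pMl ?(ltW s0)// mul0r.
- transitivity (\int[mu]_x (Num.max (- f x) 0)%:E)%E.
    by apply: eq_integral => x _; rewrite funenegE/= -EFin_max.
  rewrite (ge0_integral_affine b s0); last 2 first.
  + apply: continuous_maxr => x; last exact: cst_continuous.
    by apply: continuousN; exact: cf.
  + by move=> x; rewrite le_max lexx orbT.
  by apply: eq_integral => x _; rewrite funenegE/= -EFin_max maxr_pMl ?(ltW s0)// mul0r mulNr.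
Qed.

Lemma le_integrableR (f g : R -> R) : measurable_fun setT f ->
  (forall x, `|f x| <= g x) -> mu.-integrable setT (EFin \o g) ->
  mu.-integrable setT (EFin \o f).
Proof.
move=> mf fg ig; apply: le_integrable ig => //; first exact/measurable_EFinP.
by move=> x _ /=; rewrite lee_fin (le_trans (fg x))// ler_norm.
Qed.

Lemma integrable_scaleR (c : R) f : mu.-integrable setT (EFin \o f) ->
  mu.-integrable setT (EFin \o (fun x => c * f x)).
Proof. by move=> fi; have := integrableZl measurableT c fi; apply. Qed.

Lemma integrable_addR f g : mu.-integrable setT (EFin \o f) ->
  mu.-integrable setT (EFin \o g) ->
  mu.-integrable setT (EFin \o (fun x => f x + g x)).
Proof. by move=> fi gi; have := integrableD measurableT fi gi; apply. Qed.

Lemma le_norm_Rintegral (f g : R -> R) : measurable_fun setT f ->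
  (forall x, `|f x| <= g x) -> mu.-integrable setT (EFin \o g) ->
  `|\int[mu]_x f x| <= \int[mu]_x g x.
Proof.
move=> mf fg ig; have ifi := le_integrableR mf fg ig.
apply: le_trans (le_normr_Rintegral measurableT ifi) _.
apply: le_Rintegral => //; exact: integrable_norm.
Qed.

(** Dominated convergence. Integrability of the limit belongs to the conclusion because the limit
    will be an integral against a step function that is known only as a pointwise limit. *)
Lemma Rintegral_cvg (f_ : nat -> R -> R) f g :
  (forall n, measurable_fun setT (f_ n)) ->
  (forall x, f_ ^~ x @ \oo --> f x) ->
  mu.-integrable setT (EFin \o g) ->
  (forall n x, `|f_ n x| <= g x) ->
  mu.-integrable setT (EFin \o f) /\
  (fun n => \int[mu]_x f_ n x) @ \oo --> \int[mu]_x f x.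
Proof.
move=> mf ff ig fg.
have mfl : measurable_fun setT f.
  by apply: (measurable_fun_cvg mf) => x _; exact: ff.
have [|||||i _ c] := @dominated_convergence _ _ _ mu _ measurableT
    (fun n => EFin \o f_ n) (EFin \o f) (EFin \o g).
- by move=> n; apply/measurable_EFinP; exact: mf.
- by apply/measurable_EFinP.
- by apply: aeW => x _; apply: cvg_EFin; [exact: nearW|exact: ff].
- exact: ig.
- by apply: aeW => x n _; rewrite lee_fin fg.
split=> //; apply: fine_cvg; rewrite fineK//; exact: integrable_fin_num.
Qed.

(** The window from [u] to [v] localizes the domination: the Gaussian bounds below are uniform only
    for bounded x and for s away from 0 and infinity. *)
Lemma is_derive_under_integral (k k' : R -> R -> R) (g : R -> R) (u v a : R) :
  u < a < v ->
  (forall l, u < l < v -> measurable_fun setT (k l)) ->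
  (forall l y, u < l < v -> `|k l y| <= g y) ->
  (forall l y, u < l < v -> is_derive l 1 (k ^~ y) (k' l y)) ->
  (forall l y, u < l < v -> `|k' l y| <= g y) ->
  mu.-integrable setT (EFin \o g) ->
  is_derive a 1 (fun l => \int[mu]_y k l y) (\int[mu]_y k' a y).
Proof.
move=> uav mk kg dk k'g ig.
have I l : `]u, v[%classic l -> u < l < v by rewrite /= in_itv.
have pE l y : u < l < v -> partial1of2 k l y = k' l y.
  by move=> /(dk _ y) ?; rewrite partial1of2E derive_val.
have h1 x : `]u, v[%classic x -> mu.-integrable setT (EFin \o k x).
  by move=> /I Ix; apply: le_integrableR ig => [|y]; [exact: mk|exact: kg].
have h2 x y : `]u, v[%classic x -> setT y -> derivable (k ^~ y) x 1.
  by move=> /I /(dk _ y) [].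
have h3 y : 0 <= g y by rewrite (le_trans _ (kg a y uav)).
have h4 x y : `]u, v[%classic x -> setT y -> `|partial1of2 k x y| <= g y.
  by move=> /I Ix _; rewrite pE// k'g.
have Ia : `]u, v[%classic a by rewrite /= in_itv.
apply: DeriveDef.
  exact: (derivable_under_integral measurableT Ia h1 h2 h3 ig h4).
rewrite -derive1E (differentiation_under_integral measurableT Ia h1 h2 h3 ig h4).
by apply: eq_Rintegral => y _; rewrite pE.
Qed.

End LebesgueIntegral.

(** * Derivatives of the Gaussian and their decay *)

Section GaussianKernels.
Context {R : realType}.
Notation mu := (@lebesgue_measure R).
Implicit Types (x y s t : R) (n : nat).

(** Since |y| <= 1 + y^2, and (2 + 1/k) (1 + k y^2) >= 2 + y^2. *)
Lemma le1D_norm_expR (k y : R) : 0 < k ->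
  1 + `|y| <= (2 + k^-1) * expR (k * y ^+ 2).
Proof.
move=> k0; apply: (@le_trans _ _ ((2 + k^-1) * (1 + k * y ^+ 2))); last first.
  by rewrite ler_pM2l ?expR_ge1Dx// addr_gt0// invr_gt0.
rewrite mulrDl mulrDr mulr1 mulrDr mulr1 mulKf ?gt_eqF//.
have h : `|y| <= 1 + y ^+ 2.
  by rewrite -[y ^+ 2]real_normK ?num_real//; have := sqr_ge0 (`|y| - 1); nra.
have h1 : 0 < k^-1 by rewrite invr_gt0.
have h2 : 0 <= 2 * (k * y ^+ 2) by rewrite mulr_ge0// mulr_ge0 ?sqr_ge0// ltW.
lra.
Qed.

(** Horner induction: each new factor s is paid for by half of the exponent, so [d] must vary in the
    induction. *)
Lemma poly_le_expR (p : {poly R}) (d : R) : 0 < d ->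
  exists2 C : R, 0 < C & forall s, `|p.[s]| <= C * expR (d * s ^+ 2).
Proof.
elim/poly_ind: p d => [|p c IH] d d0.
  by exists 1 => // s; rewrite horner0 normr0 mul1r expR_ge0.
have d2 : 0 < d / 2 by rewrite divr_gt0.
have [C C0 hC] := IH _ d2.
have K0 : 0 < 2 + (d / 2)^-1 by rewrite addr_gt0// invr_gt0.
exists (C * (2 + (d / 2)^-1) + `|c|); first by rewrite ltr_pwDl ?mulr_gt0.
move=> s; rewrite hornerMXaddC (le_trans (ler_normD _ _))// mulrDl lerD//.
  rewrite normrM (_ : d * s ^+ 2 = d / 2 * s ^+ 2 + d / 2 * s ^+ 2); last by lra.
  rewrite expRD mulrACA ler_pM// (le_trans _ (le1D_norm_expR s d2))//.
  by rewrite lerDr.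
by rewrite ler_peMr// -expR0 ler_expR mulr_ge0 ?sqr_ge0// ltW.
Qed.

Lemma integrable_gauss (k C : R) : 0 < k ->
  mu.-integrable setT (EFin \o (fun y => C * expR (- (k * y ^+ 2)))).
Proof.
move=> k0.
(* The normal density of variance s^2 has the exponent - y^2 / (2 s^2), which is - k y^2 for this
   s. *)
pose s := Num.sqrt (2 * k)^-1.
have s2 : s ^+ 2 = (2 * k)^-1 by rewrite sqr_sqrtr// invr_ge0 mulr_ge0// ltW.
have s0 : s != 0 by rewrite sqrtr_eq0 -ltNge invr_gt0 mulr_gt0.
have h := integrable_normal_pdf 0 s.
rewrite (_ : EFin \o _ = (fun x => (C / normal_peak s)%:E * (normal_pdf 0 s x)%:E)%E).
  exact: integrableZl.
apply/funext => y /=; rewrite normal_pdfE// -EFinM; congr EFin.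
have p0 := normal_peak_gt0 s0.
rewrite -mulrA mulKf ?gt_eqF//; congr (_ * expR _).
by rewrite subr0 s2; field; rewrite gt_eqF.
Qed.

(** Rescaled Hermite polynomials. The recursion is (p e^(-s^2/4))' = (p' - s p / 2) e^(-s^2/4); the
    initial constant, 1 / sqrt (4 pi), gives the kernel of order 0 the mass 1. *)
Fixpoint hermite_poly n : {poly R} :=
  if n is n'.+1 then (hermite_poly n')^`() - 2^-1 *: ('X * hermite_poly n')
  else (normal_peak (Num.sqrt 2))%:P.

(* [heat_kernel n] is the n-th derivative of the heat kernel at time 1. *)
Definition heat_kernel n s : R := (hermite_poly n).[s] * expR (- (s ^+ 2 / 4)).

Lemma heat_kernel0E : heat_kernel 0 = normal_pdf 0 (Num.sqrt 2).
Proof.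
apply/funext => s; rewrite normal_pdfE ?gt_eqF ?sqrtr_gt0//.
rewrite /heat_kernel/= hornerC; congr (_ * expR _).
by rewrite subr0 sqr_sqrtr//; field.
Qed.

Lemma heat_kernel0_gt0 s : 0 < heat_kernel 0 s.
Proof.
by rewrite mulr_gt0 ?expR_gt0//= hornerC normal_peak_gt0.
Qed.

Lemma heat_kernel0_even s : heat_kernel 0 (- s) = heat_kernel 0 s.
Proof. by rewrite /heat_kernel/= !hornerC sqrrN. Qed.

Lemma heat_kernel0_le s t : `|s| <= `|t| -> heat_kernel 0 t <= heat_kernel 0 s.
Proof.
move=> st; rewrite /heat_kernel/= !hornerC ler_wpM2l ?normal_peak_ge0//.
rewrite ler_expR lerN2 ler_wpM2r// -(real_normK (num_real s)).
by rewrite -(real_normK (num_real t)) lerXn2r ?nnegrE.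
Qed.

Lemma Rintegral_heat_kernel0 : \int[mu]_s heat_kernel 0 s = 1.
Proof. by rewrite heat_kernel0E /Rintegral integral_normal_pdf. Qed.

Lemma is_derive_heat_kernel n s :
  is_derive s 1 (heat_kernel n) (heat_kernel n.+1 s).
Proof.
have h1 : is_derive s 1 (fun x => (hermite_poly n).[x]) (hermite_poly n)^`().[s].
  exact: is_derive_poly.
have h2 : is_derive s 1 (fun x => expR (- (x ^+ 2 / 4))) (expR (- (s ^+ 2 / 4)) * (- (s / 2))).
  apply: (@is_derive1_comp _ expR (fun x => - (x ^+ 2 / 4))).
  apply: is_derive_eq.
  by rewrite /GRing.scale/=; field.
apply: is_derive_eq.
rewrite /GRing.scale/= /heat_kernel/= hornerD hornerN hornerZ hornerM hornerX.
by field.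
Qed.

Lemma continuous_heat_kernel n : continuous (heat_kernel n).
Proof.
move=> s; apply: differentiable_continuous; apply/derivable1_diffP.
by have [] := is_derive_heat_kernel n s.
Qed.

(** Differentiate G' = - s G / 2 once. This is the heat equation for the self-similar kernel G (x /
    s) / s with s = sqrt t: it converts a derivative in s into two derivatives in x. *)
Lemma heat_kernel_self_similar s :
  s * heat_kernel 1 s = - (2 * heat_kernel 2 s + heat_kernel 0 s).
Proof.
rewrite /heat_kernel/= !(derivC, derivB, derivZ, derivM, derivX, mul0r, mul1r, mulr0, addr0, sub0r, derivN).
by rewrite !(hornerD, hornerN, hornerZ, hornerM, hornerX, hornerC); field.
Qed.

(** The fraction [d] of the exponent absorbs the polynomial factor. *)
Lemma heat_kernel_le n (d : R) : 0 < d ->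
  exists2 C : R, 0 < C & forall s,
    `|heat_kernel n s| <= C * expR (- ((1 - d) * (s ^+ 2 / 4))).
Proof.
move=> d0; have d4 : 0 < d / 4 by rewrite divr_gt0.
have [C C0 hC] := poly_le_expR (hermite_poly n) d4.
exists C => // s; rewrite normrM [X in _ * X]ger0_norm ?expR_ge0//.
rewrite [X in _ <= C * expR X](_ : _ = d / 4 * s ^+ 2 + - (s ^+ 2 / 4)); last by field.
by rewrite expRD mulrA ler_wpM2r ?expR_ge0.
Qed.

(** The inequality (x - y)^2 >= y^2 / 2 - x^2 recentres the Gaussian at 0 at the price of a
    constant. It leaves the exponent 2 K y^2, half of which absorbs the linear factor. *)
Lemma gauss_shift_le (k X s1 s2 : R) : 0 < k -> 0 < s1 -> 0 < s2 ->
  exists C : R, exists2 K : R, 0 < K & 0 < C /\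
    forall x s y, `|x| <= X -> s1 <= s <= s2 ->
    expR (- (k * ((x - y) / s) ^+ 2)) * (1 + `|y|) <= C * expR (- (K * y ^+ 2)).
Proof.
move=> k0 s10 s20; pose K := k / (4 * s2 ^+ 2).
have K0 : 0 < K by rewrite divr_gt0// mulr_gt0// exprn_gt0.
exists (expR (k * X ^+ 2 / s1 ^+ 2) * (2 + K^-1)); exists K => //; split.
  by rewrite mulr_gt0 ?expR_gt0// addr_gt0// invr_gt0.
move=> x s y xX /andP[s1s ss2].
have s0 : 0 < s by exact: lt_le_trans s1s.
have [s0' s10' s20'] : [/\ 0 <= s, 0 <= s1 & 0 <= s2] by rewrite !ltW.
have h1 : - (k * ((x - y) / s) ^+ 2) <= k * X ^+ 2 / s1 ^+ 2 - 2 * K * y ^+ 2.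
  have e1 : (y ^+ 2 / 2 - x ^+ 2) / s ^+ 2 <= ((x - y) / s) ^+ 2.
    rewrite expr_div_n ler_wpM2r ?invr_ge0 ?sqr_ge0//.
    by have := sqr_ge0 (2 * x - y); nra.
  have e2 : x ^+ 2 / s ^+ 2 <= X ^+ 2 / s1 ^+ 2.
    rewrite ler_pM ?sqr_ge0 ?invr_ge0 ?sqr_ge0//.
      by rewrite -(real_normK (num_real x)) lerXn2r ?nnegrE// (le_trans _ xX).
    by rewrite lef_pV2 ?posrE ?exprn_gt0// lerXn2r.
  have e3 : y ^+ 2 / s2 ^+ 2 <= y ^+ 2 / s ^+ 2.
    rewrite ler_wpM2l ?sqr_ge0// lef_pV2 ?posrE ?exprn_gt0//.
    by rewrite lerXn2r.
  have e4 : y ^+ 2 / s2 ^+ 2 / 2 - X ^+ 2 / s1 ^+ 2 <= ((x - y) / s) ^+ 2.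
    apply: le_trans e1; rewrite mulrBl [_ / 2 / _]mulrAC; lra.
  rewrite (_ : 2 * K * y ^+ 2 = k * (y ^+ 2 / s2 ^+ 2 / 2)); last first.
    by rewrite /K; field; rewrite gt_eqF.
  by rewrite -mulrA; nra.
apply: (@le_trans _ _ (expR (k * X ^+ 2 / s1 ^+ 2 - 2 * K * y ^+ 2) *
    ((2 + K^-1) * expR (K * y ^+ 2)))).
  by rewrite ler_pM ?expR_ge0// ?ler_expR// ?le1D_norm_expR// addr_ge0.
rewrite mulrCA -expRD [leRHS]mulrAC -expRD mulrC le_eqVlt; apply/orP; left.
by apply/eqP; congr (expR _ * _); ring.
Qed.

End GaussianKernels.

(** * Sequential continuity and rules of differentiation *)

Section SequentialContinuity.
Context {R : realType}.

(** Prepares for dominated convergence, which is about sequences; confining them to a ball lets one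
    dominating function serve all their terms. *)
Lemma seq_continuous_pair (F : R * R -> R) (p : R * R) :
  (forall u : nat -> R * R, (forall n, ball p 1 (u n)) -> u @ \oo --> p ->
    F \o u @ \oo --> F p) ->
  {for p, continuous F}.
Proof.
move=> h; apply/cvgrPdist_lt => e e0; apply: contrapT => nn.
have /choice[u hu] : forall n : nat, exists q,
    ball p (n.+1%:R^-1) q /\ ~ (`|F p - F q| < e).
  move=> n; apply: contrapT => /forallNP k; apply: nn.
  have : nbhs p (ball p n.+1%:R^-1) by apply: nbhsx_ballx; rewrite invr_gt0.
  by apply: filterS => q pq; apply: contrapT => nq; apply: (k q).
have u1 n : ball p 1 (u n).
  by apply: le_ball (hu n).1; rewrite invf_le1// ler1n.
have up : u @ \oo --> p.
  apply/cvg_ballP => r r0; near=> n.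
  apply: le_ball (hu n).1; near: n.
  have /cvgrPdist_lt/(_ _ r0) := @cvg_harmonic R.
  apply: filterS => n; rewrite sub0r normrN => /ltW; apply: le_trans.
  exact: ler_norm.
have /cvgrPdist_lt/(_ _ e0)[N _ hN] := h u u1 up.
by apply: (hu N).2; exact: (hN N (leqnn N)).
Unshelve.
all: end_near.
Qed.

End SequentialContinuity.

Section DerivativeRules.
Context {R : realType}.

Lemma is_derive_scale (c x a : R) (f : R -> R) :
  is_derive x 1 f a -> is_derive x 1 (fun y => c * f y) (c * a).
Proof. by move=> df; have := is_deriveZ c df; apply. Qed.

Lemma is_derive_inv (x : R) : x != 0 -> is_derive x 1 (fun y : R => y^-1) (- x ^- 2).
Proof.
move=> x0; have := @is_deriveV R id x 1 1 x0 (is_derive_id x 1).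
by rewrite /GRing.scale/= mulr1.
Qed.

End DerivativeRules.

(** * The heat flow of a datum of linear growth *)

Section HeatConvolution.
Context {R : realType}.
Notation mu := (@lebesgue_measure R).
Implicit Types (f : R -> R) (B x y s t : R) (n : nat).

(** What the maximum principle uses of the heat equation at a point; [a] is the common value of w_t
    and w_xx. *)
Definition heat_at (w : R -> R -> R) x t := exists (w1 : R -> R) (a : R),
  [/\ is_derive t 1 (w x) a,
      \forall y \near x, is_derive (y : R) (1 : R) (w ^~ t) (w1 y) &
      is_derive x 1 w1 a].

(* With [s = sqrt t], this is [t^(n/2)] times the n-th space derivative at [x] of the heat
   flow of [f] at time [t]. *)
Definition conv n f x s : R :=
  s^-1 * \int[mu]_y (heat_kernel n ((x - y) / s) * f y).

(** Integrating in the variable (z - x) / sqrt t, where z is the argument of [f], removes the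
    singularity at t = 0: there the formula gives f x, and continuity up to t = 0 becomes dominated
    convergence. *)
Definition heat f x t : R :=
  \int[mu]_y (heat_kernel 0 y * f (x + Num.sqrt t * y)).

Lemma kernel_dom n (X s1 s2 : R) : 0 < s1 -> 0 < s2 ->
  exists C : R, exists2 K : R, 0 < K & 0 < C /\
    forall x s y, `|x| <= X -> s1 <= s <= s2 ->
    `|heat_kernel n ((x - y) / s)| * (1 + `|y|) <= C * expR (- (K * y ^+ 2)).
Proof.
move=> s10 s20; have h2 : 0 < 2^-1 :> R by rewrite invr_gt0.
have [C1 C10 hC1] := heat_kernel_le n h2.
(* With d = 1/2 the exponent that remains is ((x - y) / s)^2 / 8. *)
have h8 : 0 < 8^-1 :> R by rewrite invr_gt0.
have [C2 [K K0 [C20 hC2]]] := gauss_shift_le X h8 s10 s20.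
exists (C1 * C2); exists K => //; split; first by rewrite mulr_gt0.
move=> x s y xX ss; apply: (@le_trans _ _
  (C1 * expR (- (8^-1 * ((x - y) / s) ^+ 2)) * (1 + `|y|))).
  rewrite ler_wpM2r ?addr_ge0//; apply: le_trans (hC1 _) _.
  rewrite le_eqVlt; apply/orP; left; apply/eqP; congr (_ * expR _).
  by lra.
by rewrite -!mulrA ler_pM2l// hC2.
Qed.

Lemma continuous_comp_affine f (a b : R) : continuous f ->
  continuous (fun y => f (a * y + b)).
Proof.
move=> cf y; apply: (@continuous_comp _ _ _ (fun y => a * y + b) f); last exact: cf.
apply: continuousD; last exact: cst_continuous.
by apply: continuousM; [exact: cst_continuous|].
Qed.

Lemma continuous_conv_integrand n f x s : continuous f ->
  continuous (fun y => heat_kernel n ((x - y) / s) * f y).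
Proof.
move=> cf; suff ck : continuous (fun y => heat_kernel n ((x - y) / s)).
  by move=> y; apply: cvgM; [exact: ck|exact: cf].
rewrite (_ : (fun y => _) = (fun y => heat_kernel n (- s^-1 * y + x / s))).
  by apply: continuous_comp_affine; exact: continuous_heat_kernel.
by apply/funext => z; congr heat_kernel; rewrite mulrBl; ring.
Qed.

Lemma measurable_conv_integrand n f x s : continuous f ->
  measurable_fun setT (fun y => heat_kernel n ((x - y) / s) * f y).
Proof. by move=> cf; apply: continuous_measurable_fun; exact: continuous_conv_integrand. Qed.

Section LinearGrowth.
Variables (f : R -> R) (B : R).
Hypotheses (cf : continuous f) (fB : forall y, `|f y| <= B * (1 + `|y|)).

Let B0 : 0 <= B.
Proof. by have := fB 0; rewrite normr0 addr0 mulr1; exact: le_trans. Qed.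

Lemma conv_integrand_le n (X s1 s2 : R) : 0 < s1 -> 0 < s2 ->
  exists2 g : R -> R, mu.-integrable setT (EFin \o g) &
    forall x s y, `|x| <= X -> s1 <= s <= s2 ->
    `|heat_kernel n ((x - y) / s) * f y| <= g y.
Proof.
move=> s10 s20; have [C [K K0 [C0 hC]]] := kernel_dom n X s10 s20.
exists (fun y => (B * C) * expR (- (K * y ^+ 2))); first exact: integrable_gauss.
move=> x s y xX ss; rewrite normrM -mulrA.
apply: (@le_trans _ _ (`|heat_kernel n ((x - y) / s)| * (B * (1 + `|y|)))).
  by rewrite ler_wpM2l.
by rewrite mulrCA ler_wpM2l// hC.
Qed.

Lemma integrable_conv_integrand n x s : 0 < s ->
  mu.-integrable setT (EFin \o (fun y => heat_kernel n ((x - y) / s) * f y)).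
Proof.
move=> s0; have [g ig hg] := conv_integrand_le n `|x| s0 s0.
apply: le_integrableR ig; first exact: measurable_conv_integrand.
by move=> y; apply: hg => //; rewrite lexx.
Qed.

Lemma is_derive_conv_x n x s : 0 < s ->
  is_derive x 1 (conv n f ^~ s) (conv n.+1 f x s / s).
Proof.
move=> s0.
have [g ig hg] := conv_integrand_le n (`|x| + 1) s0 s0.
have [g1 ig1 hg1] := conv_integrand_le n.+1 (`|x| + 1) s0 s0.
have xb l : x - 1 < l < x + 1 -> `|l| <= `|x| + 1.
  move=> /andP[l1 l2]; rewrite -(subrK x l) addrC (le_trans (ler_normD _ _))// lerD2l.
  by rewrite ler_norml; apply/andP; split; lra.
have h : is_derive x 1 (fun l => \int[mu]_y (heat_kernel n ((l - y) / s) * f y))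
    (\int[mu]_y (heat_kernel n.+1 ((x - y) / s) / s * f y)).
  apply: (@is_derive_under_integral _ (fun l y => heat_kernel n ((l - y) / s) * f y)
    (fun l y => heat_kernel n.+1 ((l - y) / s) / s * f y)
    (fun y => g y + s^-1 * g1 y) (x - 1) (x + 1)).
  - by apply/andP; split; lra.
  - by move=> l _; exact: measurable_conv_integrand.
  - move=> l y /xb lx; rewrite -[leLHS]addr0 lerD ?hg ?lexx//.
    by rewrite mulr_ge0 ?invr_ge0 ?(ltW s0)// (le_trans _ (hg1 l s y lx _)) ?lexx.
  - move=> l y _.
    have d1 : is_derive l 1 (fun l => (l - y) / s) s^-1.
      rewrite (_ : (fun l => _) = (fun l => s^-1 * l + - y / s)).
        exact: is_derive_affine.
      by apply/funext => z; rewrite mulrBl mulNr mulrC.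
    have d2 := @is_derive1_comp _ (heat_kernel n) (fun l => (l - y) / s) l _ _ (is_derive_heat_kernel n ((l - y) / s)) d1.
    apply: is_derive_eq; rewrite /GRing.scale/=; ring.
  - move=> l y /xb lx; rewrite -[leLHS]add0r lerD//.
      by rewrite (le_trans _ (hg l s y lx _)) ?lexx.
    by rewrite mulrAC mulrC normrM gtr0_norm ?invr_gt0// ler_wpM2l ?invr_ge0 ?(ltW s0)// hg1 ?lexx.
  - rewrite (_ : EFin \o _ = (EFin \o g) \+ (fun y => (s^-1)%:E * (EFin \o g1) y))%E; last by [].
    by apply: integrableD => //; exact: integrableZl.
rewrite /conv; apply: is_derive_eq.
rewrite /GRing.scale/= -[RHS]mulrA; congr (_ * _).
rewrite -RintegralZr//; last exact: integrable_conv_integrand.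
by apply: eq_Rintegral => y _; rewrite mulrAC.
Qed.

(** By [heat_kernel_self_similar] the terms without derivatives cancel and 2 s^-2 times the integral
    against G'' remains: the heat equation in the variable s = sqrt t, where d/ds = 2 s d/dt. *)
Lemma is_derive_conv_s x s : 0 < s ->
  is_derive s 1 (conv 0 f x) (2 * conv 2 f x s / s).
Proof.
move=> s0.
have s20 : 0 < s / 2 by rewrite divr_gt0.
have s30 : 0 < s * 2 by rewrite mulr_gt0.
have [g ig hg] := conv_integrand_le 0 `|x| s20 s30.
have [g2 ig2 hg2] := conv_integrand_le 2 `|x| s20 s30.
have sb l : s / 2 < l < s * 2 -> 0 < l /\ s / 2 <= l <= s * 2.
  by move=> /andP[l1 l2]; split; [lra|apply/andP; split; lra].
have g0 y : 0 <= g y.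
  rewrite (le_trans _ (hg x s y (lexx _) _))//.
  by apply/andP; split; lra.
have g20 y : 0 <= g2 y.
  rewrite (le_trans _ (hg2 x s y (lexx _) _))//.
  by apply/andP; split; lra.
pose k' l y := (2 * (heat_kernel 2 ((x - y) / l) * f y) + heat_kernel 0 ((x - y) / l) * f y) / l.
have h : is_derive s 1 (fun l => \int[mu]_y (heat_kernel 0 ((x - y) / l) * f y))
    (\int[mu]_y k' s y).
  apply: (@is_derive_under_integral _ (fun l y => heat_kernel 0 ((x - y) / l) * f y) k'
    (fun y => g y + (s / 2)^-1 * (2 * g2 y + g y)) (s / 2) (s * 2)).
  - by apply/andP; split; lra.
  - by move=> l _; exact: measurable_conv_integrand.
  - move=> l y /sb[l0 lb]; rewrite -[leLHS]addr0 lerD ?hg//.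
    by rewrite mulr_ge0 ?invr_ge0 ?(ltW s20)// addr_ge0// mulr_ge0.
  - move=> l y /sb[l0 lb].
    have d1 : is_derive l 1 (fun l => (x - y) / l) (- (x - y) / l / l).
      apply: is_derive_eq (is_derive_scale (x - y) (is_derive_inv (lt0r_neq0 l0))) _.
      by field; rewrite gt_eqF.
    have d2 := @is_derive1_comp _ (heat_kernel 0) (fun l => (x - y) / l) l _ _ (is_derive_heat_kernel 0 ((x - y) / l)) d1.
    apply: is_derive_eq; rewrite /GRing.scale/= /k' mulr0 add0r.
    have e := heat_kernel_self_similar ((x - y) / l).
    rewrite (_ : _ * (- _ / l / l) = - ((x - y) / l * heat_kernel 1 ((x - y) / l)) / l); last by ring.
    by rewrite e opprK; ring.
  - move=> l y /sb[l0 /andP[lb1 lb2]]; rewrite -[leLHS]add0r lerD// normrM mulrC.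
    apply: ler_pM => //.
      by rewrite ger0_norm ?invr_ge0 ?(ltW l0)// lef_pV2 ?posrE.
    rewrite (le_trans (ler_normD _ _))// lerD//; last by rewrite hg// lb1.
    by rewrite normrM ger0_norm// ler_pM2l// hg2// lb1.
  - rewrite (_ : EFin \o _ = (EFin \o g) \+ (fun y => ((s / 2)^-1)%:E *
      ((fun y => 2%:E * (EFin \o g2) y) \+ (EFin \o g)) y))%E; last by [].
    apply: integrableD => //; apply: integrableZl => //; apply: integrableD => //.
    exact: integrableZl.
have dV := is_derive_inv (lt0r_neq0 s0).
rewrite /conv; apply: is_derive_eq.
rewrite /GRing.scale/=.
have -> : \int[mu]_y k' s y = (2 * (\int[mu]_y (heat_kernel 2 ((x - y) / s) * f y)) +
    \int[mu]_y (heat_kernel 0 ((x - y) / s) * f y)) / s.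
  have i2 := integrable_conv_integrand 2 x s0.
  have i0 := integrable_conv_integrand 0 x s0.
  have i2' : mu.-integrable setT (EFin \o (fun y => 2 * (heat_kernel 2 ((x - y) / s) * f y))).
    exact: integrable_scaleR.
  rewrite RintegralZr//; last first.
    exact: integrable_addR.
  by rewrite RintegralD// RintegralZl.
by field; rewrite gt_eqF.
Qed.

End LinearGrowth.

Lemma linear_growth_scale f B s y : 0 < s -> (forall y, `|f y| <= B * (1 + `|y|)) ->
  `|f (s * y)| <= B * (1 + s) * (1 + `|y|).
Proof.
move=> s0 fB; have B0 : 0 <= B.
  by have := fB 0; rewrite normr0 addr0 mulr1; exact: le_trans.
apply: le_trans (fB _) _; rewrite -mulrA ler_wpM2l//.
by rewrite normrM gtr0_norm// mulrDl mul1r mulrDr mulr1; have := normr_ge0 y; nra.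
Qed.

Lemma continuous_scale f s : continuous f -> continuous (fun y => f (s * y)).
Proof.
by move=> cf; have := @continuous_comp_affine f s 0 cf; under eq_fun do rewrite addr0.
Qed.

(** The passage to xi = x / sqrt t: time survives only as a dilation of the datum, and the kernel is
    the unit one. *)
Lemma conv_scale f B n x s : continuous f -> (forall y, `|f y| <= B * (1 + `|y|)) -> 0 < s ->
  conv n f (s * x) s = conv n (fun y => f (s * y)) x 1.
Proof.
move=> cf fB s0; rewrite /conv invr1 mul1r.
rewrite (Rintegral_affine 0 s0); last exact: continuous_conv_integrand.
rewrite (_ : (fun y => _) = (fun y => (heat_kernel n ((x - y) / 1) * f (s * y)) * s)); last first.
  apply/funext => y; rewrite addr0; congr (heat_kernel _ _ * _ * _).
  by field; rewrite gt_eqF.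
rewrite RintegralZr//; last first.
  apply: (@integrable_conv_integrand (fun y => f (s * y)) (B * (1 + s)) _ _ n x 1 ltr01).
    exact: continuous_scale.
  by move=> y; exact: linear_growth_scale.
by rewrite mulrCA mulVf ?mulr1 ?invr1 ?gt_eqF.
Qed.

Lemma heat_integrand_le f B (X S : R) : 0 < S -> (forall y, `|f y| <= B * (1 + `|y|)) ->
  exists2 g : R -> R, mu.-integrable setT (EFin \o g) &
    forall x s y, `|x| <= X -> `|s| <= S -> `|heat_kernel 0 y * f (x + s * y)| <= g y.
Proof.
move=> S0 fB; have B0 : 0 <= B.
  by have := fB 0; rewrite normr0 addr0 mulr1; exact: le_trans.
have [C [K K0 [C0 hC]]] := kernel_dom 0 0 (@ltr01 R) ltr01.
exists (fun y => (B * (1 + X + S) * C) * expR (- (K * y ^+ 2))).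
  exact: integrable_gauss.
move=> x s y xX sS.
have X0 : 0 <= X by exact: le_trans xX.
have h : `|f (x + s * y)| <= B * (1 + X + S) * (1 + `|y|).
  apply: le_trans (fB _) _; rewrite -mulrA ler_wpM2l//.
  have := ler_normD x (s * y); rewrite normrM => h1.
  by have := normr_ge0 y; have := normr_ge0 s; nra.
have := hC 0 1 y; rewrite normr0 !lexx sub0r divr1 heat_kernel0_even => /(_ isT isT) h2.
have K1 : 0 <= B * (1 + X + S) by rewrite mulr_ge0// !addr_ge0// ltW.
rewrite normrM -[leRHS]mulrA.
apply: le_trans (ler_wpM2l (normr_ge0 _) h) _.
by rewrite mulrCA ler_wpM2l.
Qed.

Lemma measurable_heat_integrand f x s : continuous f ->
  measurable_fun setT (fun y => heat_kernel 0 y * f (x + s * y)).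
Proof.
move=> cf; apply: continuous_measurable_fun => y.
apply: cvgM; first exact: continuous_heat_kernel.
have := @continuous_comp_affine f s x cf y.
by under eq_fun do rewrite addrC.
Qed.

Lemma integrable_heat_integrand f B x s : continuous f ->
  (forall y, `|f y| <= B * (1 + `|y|)) ->
  mu.-integrable setT (EFin \o (fun y => heat_kernel 0 y * f (x + s * y))).
Proof.
move=> cf fB; have S0 : 0 < `|s| + 1 by rewrite ltr_wpDl.
have [g ig hg] := heat_integrand_le `|x| S0 fB.
apply: le_integrableR ig; first exact: measurable_heat_integrand.
by move=> y; rewrite hg// lerDl.
Qed.

Lemma heatE f B x t : continuous f -> (forall y, `|f y| <= B * (1 + `|y|)) ->
  0 < t -> heat f x t = conv 0 f x (Num.sqrt t).
Proof.
move=> cf fB t0; have s0 : 0 < Num.sqrt t by rewrite sqrtr_gt0.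
rewrite /conv (Rintegral_affine x s0); last exact: continuous_conv_integrand.
rewrite (_ : (fun y => _) = (fun y => (heat_kernel 0 y * f (x + Num.sqrt t * y)) * Num.sqrt t)); last first.
  apply/funext => y; rewrite [_ + x]addrC; congr (_ * _ * _).
  by rewrite -heat_kernel0_even; congr heat_kernel; field; rewrite gt_eqF.
rewrite RintegralZr//; last exact: (integrable_heat_integrand _ _ cf fB).
by rewrite mulrC mulfK ?gt_eqF.
Qed.

(** [Num.sqrt] is 0 on negative numbers, so the flow is frozen at [f] for t < 0 and continuity holds
    on the whole plane, across t = 0. *)
Lemma continuous_heat f B : continuous f -> (forall y, `|f y| <= B * (1 + `|y|)) ->
  continuous (fun p : R * R => heat f p.1 p.2).
Proof.
move=> cf fB p; apply: seq_continuous_pair => u pu up.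
pose S := Num.sqrt (`|p.2| + 1).
have S0 : 0 < S by rewrite sqrtr_gt0 ltr_wpDl.
have [g ig hg] := heat_integrand_le (`|p.1| + 1) S0 fB.
have u1 n : `|(u n).1| <= `|p.1| + 1.
  have [/= + _] := pu n; rewrite -ball_normE/= => h.
  rewrite -(subrK p.1 (u n).1) addrC (le_trans (ler_normD _ _))// lerD2l.
  by rewrite distrC ltW.
have u2 n : `|Num.sqrt (u n).2| <= S.
  have [/= _ +] := pu n; rewrite -ball_normE/= => h.
  rewrite ger0_norm ?sqrtr_ge0// ler_wsqrtr//.
  rewrite (le_trans (ler_norm _))// -(subrK p.2 (u n).2) addrC (le_trans (ler_normD _ _))// lerD2l.
  by rewrite distrC ltW.
have c1 : (u n).1 @[n --> \oo] --> p.1.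
  by apply: (cvg_comp u fst up); exact: cvg_fst.
have c2 : (u n).2 @[n --> \oo] --> p.2.
  by apply: (cvg_comp u snd up); exact: cvg_snd.
have c3 : Num.sqrt (u n).2 @[n --> \oo] --> Num.sqrt p.2.
  by apply: continuous_cvg c2; exact: sqrt_continuous.
apply: (@Rintegral_cvg _ (fun n y => heat_kernel 0 y * f ((u n).1 + Num.sqrt (u n).2 * y))
  (fun y => heat_kernel 0 y * f (p.1 + Num.sqrt p.2 * y)) g _ _ ig _).2.
- by move=> n; exact: measurable_heat_integrand.
- move=> y; apply: cvgM; first exact: cvg_cst.
  apply: continuous_cvg; first exact: cf.
  by apply: cvgD => //; apply: cvgM => //; exact: cvg_cst.
- by move=> n y; exact: hg.
Qed.

(** The kernel is even, so twice the value at [a] is a mean of f (a - s y) + f (a + s y) = 2 b. This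
    yields the boundary values at 0 and at L. *)
Lemma heat_reflect f B a b t : continuous f -> (forall y, `|f y| <= B * (1 + `|y|)) ->
  (forall y, f (a - y) + f (a + y) = 2 * b) -> heat f a t = b.
Proof.
move=> cf fB fab; set s := Num.sqrt t.
have i1 := integrable_heat_integrand a s cf fB.
have i2 := integrable_heat_integrand a (- s) cf fB.
have e1 : heat f a t = \int[mu]_y (heat_kernel 0 y * f (a + - s * y)).
  rewrite /heat -Rintegral_oppr; last first.
    move=> y; apply: cvgM; first exact: continuous_heat_kernel.
    have := @continuous_comp_affine f s a cf y.
    by under eq_fun do rewrite addrC.
  by apply: eq_Rintegral => y _; rewrite heat_kernel0_even mulrN mulNr.
have : heat f a t + heat f a t = 2 * b.
  rewrite {1}e1 /heat -RintegralD//.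
  under eq_Rintegral do rewrite -mulrDr mulNr fab.
  rewrite RintegralZr//; first by rewrite Rintegral_heat_kernel0 mul1r.
  by rewrite heat_kernel0E; exact: integrable_normal_pdf.
by move=> h; lra.
Qed.

Lemma heat_bounded f B x t : continuous f -> (forall y, `|f y| <= B) -> `|heat f x t| <= B.
Proof.
move=> cf fB.
have ik : mu.-integrable setT (EFin \o heat_kernel 0).
  by rewrite heat_kernel0E; exact: integrable_normal_pdf.
apply: (@le_trans _ _ (\int[mu]_y (heat_kernel 0 y * B))).
  apply: le_norm_Rintegral; first exact: measurable_heat_integrand.
    by move=> y; rewrite normrM gtr0_norm ?heat_kernel0_gt0// ler_wpM2l// ltW// heat_kernel0_gt0.
  rewrite (_ : EFin \o _ = (fun y => (EFin \o heat_kernel 0) y * B%:E)%E)//.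
  exact: integrableZr.
by rewrite RintegralZr// Rintegral_heat_kernel0 mul1r.
Qed.

Lemma heat_at_heat f B x t : continuous f -> (forall y, `|f y| <= B * (1 + `|y|)) ->
  0 < t -> heat_at (heat f) x t.
Proof.
move=> cf fB t0; set s := Num.sqrt t; have s0 : 0 < s by rewrite sqrtr_gt0.
exists (fun y => conv 1 f y s / s); exists (conv 2 f x s / s / s); split.
- have ds := is_derive_conv_s cf fB x s0.
  have := is_derive1_comp ds (is_derive1_sqrt t0).
  rewrite -/s (_ : _ * _^-1 = conv 2 f x s / s / s); last by field; rewrite gt_eqF.
  apply: near_eq_is_derive; near=> y; rewrite (heatE _ cf fB)//.
  by near: y; exact: lt_nbhsr.
- near=> y; rewrite (_ : heat f ^~ t = conv 0 f ^~ s).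
    exact: is_derive_conv_x fB _ _ _ s0.
  by apply/funext => z; rewrite (heatE _ cf fB).
- rewrite (_ : (fun y => _) = (fun y => s^-1 * conv 1 f y s)); last by apply/funext => y; rewrite mulrC.
  rewrite [X in is_derive _ _ _ X]mulrC; apply: is_derive_scale.
  exact: is_derive_conv_x fB _ _ _ s0.
Unshelve.
all: end_near.
Qed.

Lemma heat_init f x : heat f x 0 = f x.
Proof.
rewrite /heat sqrtr0.
under eq_Rintegral do rewrite mul0r addr0.
rewrite RintegralZr//; first by rewrite Rintegral_heat_kernel0 mul1r.
by rewrite heat_kernel0E; exact: integrable_normal_pdf.
Qed.

End HeatConvolution.

(** * Maximum principles on a rectangle and on the quarter plane *)

Section MaximumPrinciple.
Context {R : realType}.
Implicit Types (f : R -> R) (u v w D : R -> R -> R) (x t : R).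

Lemma is_derive_quotient_gt0 f (x a : R) : is_derive x 1 f a -> 0 < a ->
  exists2 e : R, 0 < e &
    forall h, h != 0 -> `|h| < e -> 0 < h^-1 * (f (x + h) - f x).
Proof.
move=> df a0.
have c : h^-1 *: (f (h *: 1 + x) - f x) @[h --> 0^'] --> a.
  by have [d <-] := df; exact: d.
have /nbhs_ballP[e /= e0 he] : nbhs (0 : R)
    [set h | h != 0 -> 0 < h^-1 *: (f (h *: 1 + x) - f x)].
  exact: (cvgr_gt a c _ a0).
exists e => // h h0 hle; rewrite [x + h]addrC.
have := he h; rewrite -ball_normE/= sub0r normrN => /(_ hle h0).
by rewrite /GRing.scale/= mulr1.
Qed.

(** Otherwise [f1], which vanishes at the maximum, is positive just to the right of it, and by the
    mean value theorem [f] is larger there. *)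
Lemma second_derive_max f (f1 : R -> R) (x a : R) :
  (\forall y \near x, is_derive (y : R) (1 : R) f (f1 y)) -> is_derive x 1 f1 a ->
  (\forall y \near x, f y <= f x) -> a <= 0.
Proof.
move=> df df1 fmax; rewrite leNgt; apply/negP => a0.
have /nbhs_ballP[e /= e0 he] : nbhs x [set y | is_derive (y : R) (1 : R) f (f1 y) /\ f y <= f x].
  by near=> y; split; near: y.
have {}he y : `|x - y| < e -> is_derive (y : R) (1 : R) f (f1 y) /\ f y <= f x.
  by move=> xy; apply: he; rewrite -ball_normE.
have xe y : y \in `](x - e), (x + e)[ -> `|x - y| < e.
  by rewrite in_itv/= => /andP[? ?]; rewrite ltr_norml; apply/andP; split; lra.
have f10 : f1 x = 0.
  have : is_derive x 1 f 0.
    apply: (@derive1_at_max _ f (x - e) (x + e)); first by lra.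
    - by move=> y /xe /he[[]].
    - by rewrite in_itv/=; apply/andP; split; lra.
    - by move=> y /xe /he[].
  have [|dx _] := he x; first by rewrite subrr normr0.
  by move=> [_ <-]; rewrite derive_val.
have [e1 e10 he1] := is_derive_quotient_gt0 df1 a0.
pose h := Num.min e e1 / 2.
have m0 : 0 < Num.min e e1 by rewrite lt_min e0.
have h0 : 0 < h by rewrite divr_gt0.
have hm : h < Num.min e e1 by rewrite /h; lra.
have he' : h < e by rewrite (lt_le_trans hm)// ge_min lexx.
have he1' : h < e1 by rewrite (lt_le_trans hm)// ge_min lexx orbT.
have near_x y : y \in `[x, x + h] -> `|x - y| < e.
  by rewrite in_itv/= => /andP[? ?]; rewrite ltr_norml; apply/andP; split; lra.
have xh : x < x + h by rewrite ltrDl.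
have [||c] := @MVT _ f f1 x (x + h) xh.
- by move=> y /subset_itv_oo_cc /near_x /he[].
- apply: derivable_within_continuous => y /near_x /he[[? _] _]; exact.
rewrite in_itv/= => /andP[xc cxh] e2.
have := he1 (c - x); rewrite subr_eq0 gt_eqF//= => /(_ isT).
rewrite ger0_norm; last by lra.
have /[swap]/[apply] : c - x < e1 by lra.
rewrite [x + _]addrC subrK f10 subr0 pmulr_rgt0; last by rewrite invr_gt0; lra.
move=> c0; have [|_] := he (x + h); first by apply: near_x; rewrite in_itv/= lexx andbT ltW.
by rewrite -subr_le0 e2 addrC addKr leNgt mulr_gt0.
Unshelve.
all: end_near.
Qed.

(** Only earlier times are compared, because the maximum over a rectangle may lie at the final
    time. *)
Lemma left_derive_max (g : R -> R) (t a : R) : 0 < t -> is_derive t 1 g a ->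
  (forall s, 0 <= s <= t -> g s <= g t) -> 0 <= a.
Proof.
move=> t0 dg gmax; rewrite leNgt; apply/negP => a0.
have [||e e0 he] := @is_derive_quotient_gt0 (fun s => (-1) * g s) t (- a).
- by rewrite -[X in is_derive _ _ _ X]mulN1r; exact: is_derive_scale.
- by rewrite oppr_gt0.
pose h := Num.min t e / 2.
have m0 : 0 < Num.min t e by rewrite lt_min e0 t0.
have h0 : 0 < h by rewrite divr_gt0.
have hm : h < Num.min t e by rewrite /h; lra.
have ht : h < t by rewrite (lt_le_trans hm)// ge_min lexx.
have he' : h < e by rewrite (lt_le_trans hm)// ge_min lexx orbT.
have := he (- h); rewrite oppr_eq0 gt_eqF// normrN gtr0_norm// => /(_ isT he').
rewrite !mulN1r opprK invrN mulNr oppr_gt0 pmulr_rlt0 ?invr_gt0//.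
have : g (t - h) <= g t by apply: gmax; apply/andP; split; lra.
lra.
Qed.

Lemma heat_at_sub u v x t : heat_at u x t -> heat_at v x t ->
  heat_at (fun x t => u x t - v x t) x t.
Proof.
move=> [u1 [a [ut ux uxx]]] [v1 [b [vt vx vxx]]].
exists (fun y => u1 y - v1 y); exists (a - b); split.
- exact: is_deriveB.
- by near=> y; apply: is_deriveB; near: y.
- exact: is_deriveB.
Unshelve.
all: end_near.
Qed.

Lemma heat_at_cst (c x t : R) : heat_at (fun _ _ => c) x t.
Proof.
exists (fun=> 0); exists 0; split; try exact: is_derive_cst.
by near=> y; exact: is_derive_cst.
Unshelve.
all: end_near.
Qed.

Lemma heat_at_barrier (c x t : R) : heat_at (fun x t => c * (x ^+ 2 + 2 * t)) x t.
Proof.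
exists (fun y => c * (2 * y)); exists (c * 2); split.
- apply: is_derive_scale; rewrite (_ : (fun s => _) = (fun s => 2 * s + x ^+ 2)).
    exact: is_derive_affine.
  by apply/funext => s; rewrite addrC.
- near=> y; apply: is_derive_scale; apply: is_derive_eq.
  by rewrite /GRing.scale/=; ring.
- apply: is_derive_scale; apply: is_derive_eq.
  by rewrite /GRing.scale/=; ring.
Unshelve.
all: end_near.
Qed.

Lemma classical_heat_at (A : set R) w x t : open A -> classical_heat A w -> A x ->
  0 < t -> heat_at w x t.
Proof.
move=> oA hw Ax t0; have [[d1 d2 d3] _ e] := hw x t Ax t0.
exists (dx w ^~ t); exists (dx (dx w) x t); split.
- by apply: (DeriveDef d1); rewrite -derive1E; exact: e.
- have : nbhs x A by exact: open_nbhs_nbhs.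
  apply: filterS => y Ay; have [[_ dy _] _ _] := hw y t Ay t0.
  by apply: (DeriveDef dy); rewrite -derive1E; exact: erefl.
- by apply: (DeriveDef d3); rewrite -derive1E; exact: erefl.
Qed.

(** Subtracting d t makes the argument strict: at a maximum of D - d t where D > 0, which is off the
    parabolic boundary, D_xx <= 0 but D_t >= d > 0. *)
Lemma max_principle (X T : R) D :
  {within `[0, X] `*` `[0, T], continuous (fun p : R * R => D p.1 p.2)} ->
  (forall x t, 0 < x < X -> 0 < t <= T -> heat_at D x t) ->
  (forall x, 0 <= x <= X -> D x 0 <= 0) ->
  (forall t, 0 <= t <= T -> D 0 t <= 0) ->
  (forall t, 0 <= t <= T -> D X t <= 0) ->
  forall x t, 0 <= x <= X -> 0 <= t <= T -> D x t <= 0.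
Proof.
move=> cD hD D0 Dl Dr x0 t0 x0X t0T; rewrite leNgt; apply/negP => Dpos.
pose A : set (R * R) := `[0, X] `*` `[0, T].
have [t00 t0T'] := andP t0T.
(* Small enough for D - d t to stay positive at (x0, t0). *)
pose d := D x0 t0 / (2 * (t0 + 1)).
have d0 : 0 < d by rewrite divr_gt0// mulr_gt0// ltr_wpDl.
have dt0 : d * t0 < D x0 t0.
  rewrite /d mulrAC ltr_pdivrMr; last by rewrite mulr_gt0// ltr_wpDl.
  by rewrite ltr_pM2l//; lra.
pose E (p : R * R) := D p.1 p.2 - d * p.2.
have cE : {within A, continuous E}.
  apply/subspace_continuousP => p Ap.
  move/subspace_continuousP : cD => /(_ p Ap) cDp.
  apply: cvgB => //; apply: cvgM; first exact: cvg_cst.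
  by apply: cvg_within_filter; exact: cvg_snd.
have cA : compact A by apply: compact_setX; exact: segment_compact.
have A0 : A (x0, t0) by split; rewrite /= in_itv/=.
have [[xm tm]] := compact_EVT_max (ex_intro _ _ A0) cA cE.
rewrite inE => -[/=]; rewrite !in_itv/= => xmX tmT Emax.
have {}Emax x t : 0 <= x <= X -> 0 <= t <= T -> D x t - d * t <= D xm tm - d * tm.
  by move=> xX tT; apply: (Emax (x, t)); rewrite inE; split; rewrite /= in_itv/=.
have [xm0 xmX'] := andP xmX; have [tm0 tmT'] := andP tmT.
have Dm : 0 < D xm tm.
  have := Emax _ _ x0X t0T; have : 0 <= d * tm by rewrite mulr_ge0// ltW.
  lra.
have xm_gt0 : 0 < xm.
  rewrite lt_neqAle xm0 andbT; apply/eqP => e; move: Dm.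
  by rewrite -e ltNge Dl.
have xm_ltX : xm < X.
  by rewrite lt_neqAle xmX' andbT; apply/eqP => e; move: Dm; rewrite e ltNge Dr.
have tm_gt0 : 0 < tm.
  rewrite lt_neqAle tm0 andbT; apply/eqP => e; move: Dm.
  by rewrite -e ltNge D0.
have := hD xm tm; rewrite xm_gt0 xm_ltX tm_gt0 tmT' => /(_ isT isT)[w1 [a [wt wx wxx]]].
have a0 : a <= 0.
  apply: (second_derive_max wx wxx).
  near=> y; have := Emax y tm _ tmT; rewrite lerD2r; apply.
  by apply/andP; split; apply: ltW; near: y; [exact: lt_nbhsr|exact: lt_nbhsl].
have : 0 <= a - d.
  apply: (@left_derive_max (fun s => D xm s - d * s) tm) => //.
    apply: is_deriveB; rewrite -[X in is_derive _ _ _ X]mulr1; apply: is_derive_scale.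
  move=> s /andP[s0 st]; apply: Emax => //.
  by rewrite s0 (le_trans st).
lra.
Unshelve.
all: end_near.
Qed.

(** Phragmen-Lindelof argument: the caloric barrier c (x^2 + 2 t) exceeds [B] at a distant right
    end, and then c tends to 0. *)
Lemma max_principle_halfline (B : R) D :
  {within `[0, +oo[ `*` `[0, +oo[, continuous (fun p : R * R => D p.1 p.2)} ->
  (forall x t, 0 < x -> 0 < t -> heat_at D x t) ->
  (forall x t, 0 <= x -> 0 <= t -> D x t <= B) ->
  (forall x, 0 <= x -> D x 0 <= 0) ->
  (forall t, 0 <= t -> D 0 t <= 0) ->
  forall x t, 0 <= x -> 0 <= t -> D x t <= 0.
Proof.
move=> cD hD DB D0 Dl x t x0 t0.
suff H c : 0 < c -> D x t <= c * (x ^+ 2 + 2 * t).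
  apply/ler_addgt0Pr => e e0; rewrite add0r.
  have s0 : 0 < x ^+ 2 + 2 * t + 1 by rewrite ltr_wpDl// addr_ge0 ?sqr_ge0// mulr_ge0.
  apply: le_trans (H (e / (x ^+ 2 + 2 * t + 1)) _) _; first by rewrite divr_gt0.
  by rewrite mulrAC ler_pdivrMr// ler_pM2l// lerDl.
move=> c0; rewrite -subr_le0.
(* X >= 1 and c X >= |B| give c X^2 >= B on the artificial boundary. *)
pose X := x + 1 + `|B| / c.
have Bc : 0 <= `|B| / c by rewrite divr_ge0// ltW.
apply: (@max_principle X t (fun x t => D x t - c * (x ^+ 2 + 2 * t))).
- have : {within `[0, X] `*` `[0, t], continuous (fun p : R * R => D p.1 p.2)}.
    apply: continuous_subspaceW cD => -[y s] [/=]; rewrite !in_itv/= => /andP[-> _] /andP[-> _].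
    by [].
  move=> cD'; apply/subspace_continuousP => p Ap.
  move/subspace_continuousP : cD' => /(_ p Ap) cDp.
  apply: cvgB => //; apply: cvg_within_filter.
  apply: cvgM; first exact: cvg_cst.
  apply: cvgD; first by apply: cvgM; exact: cvg_fst.
  by apply: cvgM; [exact: cvg_cst|exact: cvg_snd].
- move=> y s /andP[y0 _] /andP[s0 _]; apply: heat_at_sub; first exact: hD.
  exact: heat_at_barrier.
- move=> y /andP[y0 _]; rewrite mulr0 addr0 subr_le0 (le_trans (D0 _ y0))//.
  by rewrite mulr_ge0 ?sqr_ge0// ltW.
- move=> s /andP[s0 _]; rewrite expr0n/= add0r subr_le0 (le_trans (Dl _ s0))//.
  by rewrite mulr_ge0 ?mulr_ge0// ltW.
- move=> s /andP[s0 _]; rewrite subr_le0 (le_trans (DB _ _ _ s0))//.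
    by rewrite /X !addr_ge0.
  have X1 : 1 <= X by rewrite /X; lra.
  have cX : `|B| <= c * X.
    by rewrite mulrC -ler_pdivrMr// /X; lra.
  have := ler_norm B; have : 0 <= c * s by rewrite mulr_ge0// ltW.
  have : c * X <= c * X ^+ 2 by rewrite ler_pM2l// expr2 ler_peMr//; lra.
  lra.
- by rewrite x0 /X; lra.
- by rewrite t0 lexx.
Qed.

End MaximumPrinciple.

(** * Quantitative calculus in C^k *)

Section DifferentiabilityClass.
Context {R : realType}.
Variable a : R.
Implicit Types (f g : R -> R) (k : nat) (B : R).

Let I x := 0 <= x <= a.

(* The derivatives are witnesses rather than [derive1n], so that sums, products and
   inverses need only be differentiated pointwise, including at the endpoints. *)
Fixpoint Ck_bounded k B f : Prop :=
  (forall x, I x -> `|f x| <= B) /\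
  if k is k'.+1 then
    exists f', (forall x, I x -> is_derive x 1 f (f' x)) /\ Ck_bounded k' B f'
  else forall x, I x -> {for x, continuous f}.

Lemma Ck_bounded_norm k B f : Ck_bounded k B f -> forall x, I x -> `|f x| <= B.
Proof. by case: k => [|k] []. Qed.

Lemma Ck_bounded_continuous k B f : Ck_bounded k B f -> forall x, I x -> {for x, continuous f}.
Proof.
case: k => [|k] [] // _ [f' [df _]] x Ix; apply: differentiable_continuous.
by apply/derivable1_diffP; have [] := df x Ix.
Qed.

Lemma Ck_boundedS k B f : Ck_bounded k.+1 B f -> Ck_bounded k B f.
Proof.
elim: k f => [|k IH] f h.
  by split; [exact: Ck_bounded_norm h|exact: Ck_bounded_continuous h].
have [hB [f' [df hf']]] := h; split=> //; exists f'; split=> //; exact: IH.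
Qed.

Lemma Ck_bounded_le k B B' f : B <= B' -> Ck_bounded k B f -> Ck_bounded k B' f.
Proof.
move=> BB'; elim: k f => [|k IH] f [hB h]; split; try by move=> x /hB /le_trans; apply.
- exact: h.
- by have [f' [df hf']] := h; exists f'; split=> //; exact: IH.
Qed.

Lemma Ck_bounded_cst k B c : `|c| <= B -> Ck_bounded k B (fun=> c).
Proof.
elim: k c => [|k IH] c cB; split => //; first by move=> x _; exact: cst_continuous.
exists (fun=> 0); split; first by move=> x _; exact: is_derive_cst.
by apply: IH; rewrite normr0 (le_trans _ cB).
Qed.

Lemma Ck_boundedD k B B' f g : Ck_bounded k B f -> Ck_bounded k B' g ->
  Ck_bounded k (B + B') (fun x => f x + g x).
Proof.
elim: k f g => [|k IH] f g [fB hf] [gB hg]; split;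
  try by move=> x Ix; rewrite (le_trans (ler_normD _ _))// lerD ?fB ?gB.
- by move=> x Ix; apply: continuousD; [exact: hf|exact: hg].
- have [f' [df hf']] := hf; have [g' [dg hg']] := hg.
  exists (fun x => f' x + g' x); split; last exact: IH.
  by move=> x Ix; apply: is_deriveD; [exact: df|exact: dg].
Qed.

Lemma Ck_boundedN k B f : Ck_bounded k B f -> Ck_bounded k B (fun x => - f x).
Proof.
elim: k f => [|k IH] f [fB hf]; split; try by move=> x Ix; rewrite normrN fB.
- by move=> x Ix; apply: continuousN; exact: hf.
- have [f' [df hf']] := hf; exists (fun x => - f' x); split; last exact: IH.
  by move=> x Ix; apply: is_deriveN; exact: df.
Qed.

(** By the Leibniz rule each of the k differentiations doubles the number of products, whence
    2^k. *)
Lemma Ck_boundedM k B B' f g : 0 <= B -> 0 <= B' ->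
  Ck_bounded k B f -> Ck_bounded k B' g ->
  Ck_bounded k (2 ^+ k * (B * B')) (fun x => f x * g x).
Proof.
move=> B0 B'0; elim: k f g => [|k IH] f g hf hg.
  split=> x Ix; first by rewrite expr0 mul1r normrM ler_pM// ?(Ck_bounded_norm hf)// (Ck_bounded_norm hg).
  by apply: cvgM; [exact: (Ck_bounded_continuous hf)|exact: (Ck_bounded_continuous hg)].
split.
  move=> x Ix; rewrite normrM (@le_trans _ _ (B * B'))//.
    by rewrite ler_pM// ?(Ck_bounded_norm hf)// (Ck_bounded_norm hg).
  by rewrite ler_peMl ?mulr_ge0// exprn_ege1// ler1n.
have [_ [f' [df hf']]] := hf; have [_ [g' [dg hg']]] := hg.
exists (fun x => f x * g' x + g x * f' x); split.
  by move=> x Ix; apply: is_deriveM; [exact: df|exact: dg].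
rewrite (_ : 2 ^+ k.+1 * (B * B') = 2 ^+ k * (B * B') + 2 ^+ k * (B' * B)); last first.
  by rewrite exprS; ring.
apply: Ck_boundedD; first by apply: IH => //; exact: Ck_boundedS.
have := IH g f'; rewrite (mulrC B' B).
have e : (fun x => g x * f' x) = (fun x => f' x * g x) by apply/funext => x; rewrite mulrC.
by rewrite e => _; apply: IH => //; exact: Ck_boundedS.
Qed.

(** Follows the recursion (1/f)' = - f' (1/f) (1/f); it sees [f] only through an upper bound [B] in
    C^k and a lower bound [m]. *)
Fixpoint inverse_bound k B m : R :=
  if k is k'.+1 then
    m^-1 + 2 ^+ k' * (B * (2 ^+ k' * (inverse_bound k' B m * inverse_bound k' B m)))
  else m^-1.

Lemma inverse_bound_ge0 k B m : 0 <= B -> 0 < m -> 0 <= inverse_bound k B m.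
Proof.
move=> B0 m0; elim: k => [|k IH] /=; first by rewrite invr_ge0 ltW.
by rewrite addr_ge0 ?invr_ge0 ?(ltW m0)// !mulr_ge0// exprn_ge0.
Qed.

Lemma Ck_boundedV k B m f : 0 <= B -> 0 < m -> (forall x, I x -> m <= f x) ->
  Ck_bounded k B f -> Ck_bounded k (inverse_bound k B m) (fun x => (f x)^-1).
Proof.
move=> B0 m0 fm.
have f0 x : I x -> 0 < f x by move=> /fm; exact: lt_le_trans.
have fV x : I x -> `|(f x)^-1| <= m^-1.
  move=> Ix; rewrite ger0_norm; last by rewrite invr_ge0 ltW// f0.
  by rewrite lef_pV2 ?posrE ?f0// fm.
elim: k => [|k IH] hf /=.
  split=> // x Ix; apply: cvgV; first by rewrite gt_eqF ?f0.
  exact: (Ck_bounded_continuous hf).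
have i0 := inverse_bound_ge0 k B0 m0.
split.
  move=> x Ix; rewrite (le_trans (fV x Ix))// lerDl !mulr_ge0// exprn_ge0//.
have [_ [f' [df hf']]] := hf.
have hV := IH (Ck_boundedS hf).
exists (fun x => - (f' x * ((f x)^-1 * (f x)^-1))); split.
  move=> x Ix; have n0 : f x != 0 by rewrite gt_eqF ?f0.
  apply: is_derive_eq (is_deriveV n0 (df x Ix)) _.
  by rewrite /GRing.scale/=; field.
apply: (@Ck_bounded_le _ (2 ^+ k * (B * (2 ^+ k * (inverse_bound k B m * inverse_bound k B m))))).
  by rewrite lerDr invr_ge0 ltW.
apply/Ck_boundedN/Ck_boundedM => //; first by rewrite !mulr_ge0// exprn_ge0.
exact: Ck_boundedM.
Qed.

(** Equality on an open interval passes to derivatives; so the [derive1n] of [d] are there the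
    witnesses for [f], which are continuous up to the endpoints. *)
Lemma Ck_bounded_derive1n k B f d : Ck_bounded k B f ->
  {in `]0, a[, forall x, d x = f x} ->
  exists F : nat -> R -> R, forall j, (j <= k)%N ->
    [/\ {in `]0, a[, forall x, derive1n j d x = F j x},
        forall x, I x -> {for x, continuous (F j)},
        forall x, I x -> `|F j x| <= B &
        (j < k)%N -> {in `]0, a[, forall x, derivable (derive1n j d) x 1}].
Proof.
elim: k f d => [|k IH] f d hf df.
  exists (fun=> f) => j; rewrite leqn0 => /eqP ->; split=> //.
  - exact: Ck_bounded_continuous hf.
  - exact: Ck_bounded_norm hf.
have near_d x : x \in `]0, a[ -> \forall y \near x, f y = d y.
  move=> xa; have := near_in_itvoo xa; apply: filterS => y ya.
  by rewrite df// inE.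
have oI x : x \in `]0, a[ -> I x by rewrite in_itv/= /I => /andP[/ltW -> /ltW ->].
have [_ [f' [dfx hf']]] := hf.
have dd x : x \in `]0, a[ -> is_derive x 1 d (f' x).
  by move=> xa; apply: near_eq_is_derive (near_d x xa) _; apply: dfx; exact: oI.
have [|F hF] := IH f' (derive1 d) hf'.
  by move=> x xa; rewrite derive1E; have [_ ->] := dd x xa.
exists (fun j => if j is j'.+1 then F j' else f) => -[|j] jk.
  split=> //.
  - exact: Ck_bounded_continuous hf.
  - exact: Ck_bounded_norm hf.
  - by move=> _ x xa; rewrite derive1n0; have [] := dd x xa.
have [h1 h2 h3 h4] := hF j jk; rewrite derive1Sn; split.
- exact: h1.
- exact: h2.
- exact: h3.
- exact: h4.
Qed.

Lemma Ck_bounded_in_Ck k B f d : Ck_bounded k B f ->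
  {in `]0, a[, forall x, d x = f x} -> in_Ck k a d.
Proof.
move=> hf df; have [F hF] := Ck_bounded_derive1n hf df; split=> j jk.
  by have [_ _ _ h] := hF j (ltnW jk); exact: h.
have [h1 h2 _ _] := hF j jk; exists (F j) => //.
apply/subspace_continuousP => x; rewrite /= in_itv/= => Ix.
by apply: cvg_within_filter; exact: h2.
Qed.

Lemma Ck_bounded_Ck_norm k B f d : Ck_bounded k B f ->
  {in `]0, a[, forall x, d x = f x} -> (Ck_norm k a d <= (k.+1%:R * B)%:E)%E.
Proof.
move=> hf df; have [F hF] := Ck_bounded_derive1n hf df.
have -> : ((k.+1%:R * B)%:E = \sum_(j < k.+1) B%:E :> \bar R)%E.
  by rewrite sumEFin big_const_ord iter_addr_0 mulr_natl.
apply: lee_sum => j _; apply: ge_ereal_sup => _ [x xa <-].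
have [h1 _ h3 _] := hF j (ltn_ord j); rewrite lee_fin h1//.
by apply: h3; move: xa; rewrite /= in_itv/= /I => /andP[/ltW -> /ltW ->].
Qed.

End DifferentiabilityClass.

(** * The Hopf--Cole datum and its odd reflection *)

Section HopfColeDatum.
Context {R : realType}.
Notation mu := (@lebesgue_measure R).
Variables (R0 : R) (u0 : R -> R).
Hypotheses (R0_gt0 : 0 < R0) (hu0 : L1_datum R0 u0).

Lemma hopf_cole_datum_le0 x : x <= 0 -> hopf_cole_datum u0 x = 1.
Proof.
move=> x0; rewrite /hopf_cole_datum set_itv_ge ?Rintegral_set0 ?expR0//.
by rewrite bnd_simp -leNgt.
Qed.

Lemma norm_Rintegral_datum (x : R) : `|\int[mu]_(z in `]0, x]) u0 z| <= L1_norm u0.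
Proof.
have [iu _] := hu0.
have sub : `]0, x] `<=` `]0, +oo[ by apply: subset_itvl; rewrite bnd_simp.
have ix : mu.-integrable `]0, x] (EFin \o u0) by apply: integrableS iu.
apply: le_trans (le_normr_Rintegral _ ix) _ => //.
have nx := integrable_norm ix; have nu := integrable_norm iu.
rewrite /L1_norm /Rintegral; apply: fine_le; try exact: integrable_fin_num.
by apply: ge0_subset_integral => //; have [] := integrableP _ _ _ nu.
Qed.

Lemma hopf_cole_datum_bounds x :
  expR (- L1_norm u0) <= hopf_cole_datum u0 x <= expR (L1_norm u0).
Proof. by rewrite /hopf_cole_datum !ler_expR -ler_norml; exact: norm_Rintegral_datum. Qed.

Lemma hopf_cole_datum_ge x : R0 <= x -> hopf_cole_datum u0 x = expR (mass u0).
Proof.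
move=> R0x; have [iu ae0] := hu0; congr expR; apply/esym/eqP.
rewrite -subr_eq0 /mass Rintegral_itvB//; last first.
  by rewrite bnd_simp (le_trans (ltW R0_gt0)).
rewrite /Rintegral (ae_eq_integral (cst 0%E))//.
- by rewrite integral_cst// mul0e.
- apply: measurable_int; apply: integrableS iu => //.
  by apply: subset_itvr; rewrite bnd_simp (le_trans (ltW R0_gt0)).
- have [Z [mZ Z0 sub]] := ae0; exists Z; split=> // y ny; apply: sub => /= h; apply: ny.
  by rewrite /= in_itv/= andbT => xy; rewrite h// (le_lt_trans R0x).
Qed.

Lemma mass_bounds : expR (- L1_norm u0) <= expR (mass u0) <= expR (L1_norm u0).
Proof. by rewrite -(hopf_cole_datum_ge (lexx R0)) hopf_cole_datum_bounds. Qed.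

(** Read off from the continuity of [w] up to t = 0; the maximum with 0 covers negative x, where the
    datum is 1. *)
Lemma continuous_hopf_cole_datum (w : R -> R -> R) :
  heat_halfline u0 w -> continuous (hopf_cole_datum u0).
Proof.
move=> hw; have -> : hopf_cole_datum u0 = (fun x => w (Num.max x 0) 0).
  apply/funext => x; have m0 : 0 <= Num.max x 0 by rewrite le_max lexx orbT.
  rewrite (hh_init hw m0); case: (leP x 0) => [x0|_]; last exact: erefl.
  by rewrite (hopf_cole_datum_le0 x0) (hopf_cole_datum_le0 (lexx 0)).
pose A : set (R * R) := `[0, +oo[ `*` `[0, +oo[.
have Am (y : R) : A (Num.max y 0, 0).
  by split; rewrite /= in_itv/= ?le_max lexx ?orbT.
move=> x.
have c : (fun p : R * R => w p.1 p.2) @ within A (nbhs (Num.max x 0, 0)) --> w (Num.max x 0) 0.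
  by have /subspace_continuousP/(_ _ (Am x)) := hh_continuous hw.
have d : (fun y : R => (Num.max y 0, 0 : R)) @ nbhs x --> (Num.max x 0, 0 : R).
  have d1 : Num.max y 0 @[y --> x] --> Num.max x 0.
    by apply: continuous_max; [exact: cvg_id|exact: cvg_cst].
  have d2 : (fun=> 0 : R) y @[y --> x] --> (0 : R) by exact: cvg_cst.
  exact: (cvg_pair d1 d2).
move=> P hP; have h : nbhs x (fun y : R => A (Num.max y 0, 0) -> P (w (Num.max y 0) 0)).
  exact: (d _ (c P hP)).
by apply: (@filterS _ (nbhs x) _ _ _ _ h) => y; apply; exact: Am.
Qed.

(* The odd reflection of [w_0 - 1]: [hopf_cole_datum u0] is 1 on negative numbers. *)
Definition odd_datum x : R := hopf_cole_datum u0 x - hopf_cole_datum u0 (- x).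

Lemma odd_datumN x : odd_datum (- x) = - odd_datum x.
Proof. by rewrite /odd_datum opprK opprB. Qed.

Lemma odd_datum_ge0 x : 0 <= x -> odd_datum x = hopf_cole_datum u0 x - 1.
Proof. by move=> x0; rewrite /odd_datum [in X in _ - X]hopf_cole_datum_le0 ?oppr_le0. Qed.

Lemma odd_datum_ge x : R0 <= x -> odd_datum x = expR (mass u0) - 1.
Proof.
by move=> R0x; rewrite odd_datum_ge0 ?hopf_cole_datum_ge// (le_trans (ltW R0_gt0)).
Qed.

(** The difference of two positive numbers, each at most e^(||u_0||). *)
Lemma odd_datum_norm x : `|odd_datum x| <= expR (L1_norm u0).
Proof.
have /andP[h1 h2] := hopf_cole_datum_bounds x.
have /andP[h3 h4] := hopf_cole_datum_bounds (- x).
have h5 := expR_gt0 (- L1_norm u0).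
rewrite ler_norml /odd_datum; move: h1 h2 h3 h4 h5.
move: (hopf_cole_datum u0 x) (hopf_cole_datum u0 (- x)) (expR _) (expR _) => a b c d.
by move=> *; apply/andP; split; lra.
Qed.

End HopfColeDatum.

(** * Extension of the datum to the line for the interval problem *)

Definition period_index {R : realType} (L x : R) : int := Num.floor ((x + L) / (2 * L)).

Lemma period_indexP {R : realType} (L x : R) : 0 < L ->
  - L <= x - 2 * L * (period_index L x)%:~R < L.
Proof.
move=> L0; have L2 : 0 < 2 * L by rewrite mulr_gt0.
have h1 := Num.Theory.floor_le ((x + L) / (2 * L)).
have h2 := Num.Theory.floorD1_gt ((x + L) / (2 * L)).
move: h1 h2; rewrite -/(period_index L x) ler_pdivlMr// ltr_pdivrMr// intrD.
by move=> h1 h2; apply/andP; split; lra.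
Qed.

(* An odd function equal to [m] beyond [R0] extends, from [-L, L], to the function
   which is odd about 0 and satisfies [f (2 L - x) = 2 m - f x]; it grows by [2 m]
   over each period [2 L]. *)
Section PeriodicExtension.
Context {R : realType}.
Variables (phi : R -> R) (R0 L m B : R).
Hypotheses (R0_gt0 : 0 < R0) (R0L : R0 < L) (cphi : continuous phi)
  (phiN : forall x, phi (- x) = - phi x) (phi_ge : forall x, R0 <= x -> phi x = m)
  (phiB : forall x, `|phi x| <= B).

Definition periodic_extension x : R :=
  2 * m * (period_index L x)%:~R + phi (x - 2 * L * (period_index L x)%:~R).

Let L0 : 0 < L. Proof. exact: lt_trans R0L. Qed.

Lemma phi_le x : x <= - R0 -> phi x = - m.
Proof. by move=> xR; rewrite -[x]opprK phiN phi_ge// lerNr. Qed.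

(** The index [q] may be off by one: then the two arguments of [phi] lie where it is m and - m, and
    the term 2 m q compensates the change. This freedom takes care of the jumps of [period_index] in
    the proofs of continuity, oddness and reflection. *)
Lemma periodic_extensionE (q : int) x : `|x - 2 * L * q%:~R| <= 2 * L - R0 ->
  periodic_extension x = 2 * m * q%:~R + phi (x - 2 * L * q%:~R).
Proof.
have h0 := R0_gt0; have hR := R0L; have hL := L0.
rewrite /periodic_extension; have := period_indexP x L0.
set p := period_index L x => /andP[p1 p2]; rewrite ler_norml => /andP[q1 q2].
have b1 : (-2 : R) < (q - p)%:~R.
  rewrite intrB -(ltr_pM2l L0); lra.
have b2 : (q - p)%:~R < (2 : R).
  rewrite intrB -(ltr_pM2l L0); lra.
have {}b1 : -2 < q - p by rewrite -(ltr_int R).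
have {}b2 : q - p < 2 by rewrite -(ltr_int R).
have [e|[e|e]] : q = p \/ q = p + 1 \/ q = p - 1 by lia.
- by rewrite e.
- rewrite e intrD in q1 q2 *.
  rewrite (phi_ge (x := x - 2 * L * p%:~R)); last by lra.
  by rewrite phi_le; [ring|lra].
- rewrite e intrB in q1 q2 *.
  rewrite (phi_ge (x := x - 2 * L * (p%:~R - 1))); last by lra.
  by rewrite (phi_le (x := x - 2 * L * p%:~R)); [ring|lra].
Qed.

Lemma continuous_periodic_extension : continuous periodic_extension.
Proof.
have h0 := R0_gt0; have hR := R0L; have hL := L0.
move=> x; pose q := period_index L x; have /andP[q1 q2] := period_indexP x L0.
have c : {for x, continuous (fun y => 2 * m * q%:~R + phi (y - 2 * L * q%:~R))}.
  apply: cvgD; first exact: cvg_cst.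
  apply: continuous_cvg; first exact: cphi.
  by apply: cvgB; [exact: cvg_id|exact: cvg_cst].
rewrite /continuous_at {2}/periodic_extension -/q; apply: cvg_trans c.
apply: near_eq_cvg; near=> y; rewrite (@periodic_extensionE q)//.
rewrite ler_norml; apply/andP; split; apply: ltW.
  by rewrite ltrBrDr; near: y; apply: lt_nbhsr; rewrite -/q in q1 q2; lra.
by rewrite ltrBlDr; near: y; apply: lt_nbhsl; rewrite -/q in q1 q2; lra.
Unshelve.
all: end_near.
Qed.

Lemma periodic_extensionN x : periodic_extension (- x) = - periodic_extension x.
Proof.
have h0 := R0_gt0; have hR := R0L; have hL := L0.
have /andP[q1 q2] := period_indexP x L0; set q := period_index L x in q1 q2 *.
rewrite (@periodic_extensionE (- q)) ?(@periodic_extensionE q).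
- rewrite (_ : - x - 2 * L * (- q)%:~R = - (x - 2 * L * q%:~R)); last by rewrite rmorphN/=; ring.
  by rewrite phiN rmorphN/=; ring.
- by rewrite ler_norml; apply/andP; split; lra.
- by rewrite rmorphN/= ler_norml; apply/andP; split; lra.
Qed.

Lemma periodic_extension_reflect y :
  periodic_extension (L - y) + periodic_extension (L + y) = 2 * m.
Proof.
have h0 := R0_gt0; have hR := R0L; have hL := L0.
have /andP[q1 q2] := period_indexP (L + y) L0; set q := period_index L (L + y) in q1 q2 *.
rewrite (@periodic_extensionE (1 - q)) ?(@periodic_extensionE q (L + y)).
- rewrite intrB (_ : L - y - 2 * L * (1 - q%:~R) = - (L + y - 2 * L * q%:~R)); last by ring.
  by rewrite phiN; ring.
- by rewrite ler_norml; apply/andP; split; lra.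
- by rewrite intrB ler_norml; apply/andP; split; lra.
Qed.

Lemma periodic_extension_near x : `|x| <= 2 * L - R0 -> periodic_extension x = phi x.
Proof. by move=> h; rewrite (@periodic_extensionE 0) !mulr0 ?add0r ?subr0. Qed.

(** The index q satisfies 2 L |q| <= |x| + L, and |m| <= B. *)
Lemma periodic_extension_norm x : `|periodic_extension x| <= B * (2 + `|x| / L).
Proof.
have /andP[q1 q2] := period_indexP x L0; rewrite /periodic_extension.
set q : R := (period_index L x)%:~R in q1 q2 *.
have mB : `|m| <= B by rewrite -(phi_ge (lexx R0)).
have B0 : 0 <= B by exact: le_trans mB.
have hq : 2 * `|q| <= 1 + `|x| / L.
  rewrite -(ler_pM2l L0) mulrDr [L * (_ / _)]mulrC divfK ?gt_eqF// mulr1.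
  rewrite mulrCA mulrA -(ger0_norm (ltW L0)) -(ger0_norm (ler0n R 2)) -!normrM.
  rewrite (_ : 2 * L * q = x - (x - 2 * L * q)); last by ring.
  rewrite (le_trans (ler_normB _ _))// addrC lerD2r (ger0_norm (ltW L0)) ler_norml.
  by apply/andP; split; lra.
rewrite (le_trans (ler_normD _ _))// (_ : B * _ = B * (1 + `|x| / L) + B); last by ring.
by rewrite lerD// !normrM (ger0_norm (ler0n R 2)) mulrAC mulrC ler_pM//.
Qed.

End PeriodicExtension.

(** * Comparison of solutions *)

Section Uniqueness.
Context {R : realType}.
Implicit Types (u v w : R -> R -> R) (x t L B : R).

Lemma within_continuous_sub (A : set (R * R)) (u v : R -> R -> R) :
  {within A, continuous (fun p : R * R => u p.1 p.2)} ->
  {within A, continuous (fun p : R * R => v p.1 p.2)} ->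
  {within A, continuous (fun p : R * R => u p.1 p.2 - v p.1 p.2)}.
Proof.
move=> /subspace_continuousP cu /subspace_continuousP cv.
by apply/subspace_continuousP => p Ap; apply: cvgB; [exact: cu|exact: cv].
Qed.

Lemma within_continuous_sub1 (A : set (R * R)) (u : R -> R -> R) :
  {within A, continuous (fun p : R * R => u p.1 p.2)} ->
  {within A, continuous (fun p : R * R => u p.1 p.2 - 1)}.
Proof.
move=> /subspace_continuousP cu.
by apply/subspace_continuousP => p Ap; apply: cvgB; [exact: cu|exact: cvg_cst].
Qed.

Lemma heat_le_interval L T u v :
  {within `[0, L] `*` `[0, T], continuous (fun p : R * R => u p.1 p.2)} ->
  {within `[0, L] `*` `[0, T], continuous (fun p : R * R => v p.1 p.2)} ->
  (forall x t, 0 < x < L -> 0 < t -> heat_at u x t) ->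
  (forall x t, 0 < x < L -> 0 < t -> heat_at v x t) ->
  (forall x, 0 <= x <= L -> u x 0 <= v x 0) ->
  (forall t, 0 <= t -> u 0 t <= v 0 t) ->
  (forall t, 0 <= t -> u L t <= v L t) ->
  forall x t, 0 <= x <= L -> 0 <= t <= T -> u x t <= v x t.
Proof.
move=> cu cv hu hv h0 hl hr x t xL tT; rewrite -subr_le0.
apply: (@max_principle _ L T (fun x t => u x t - v x t)) => //.
- exact: within_continuous_sub.
- move=> y s yL /andP[s0 _]; apply: heat_at_sub; [exact: hu|exact: hv].
- by move=> y yL; rewrite subr_le0 h0.
- by move=> s /andP[s0 _]; rewrite subr_le0 hl.
- by move=> s /andP[s0 _]; rewrite subr_le0 hr.
Qed.

Lemma heat_le_halfline B u v :
  {within `[0, +oo[ `*` `[0, +oo[, continuous (fun p : R * R => u p.1 p.2)} ->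
  {within `[0, +oo[ `*` `[0, +oo[, continuous (fun p : R * R => v p.1 p.2)} ->
  (forall x t, 0 < x -> 0 < t -> heat_at u x t) ->
  (forall x t, 0 < x -> 0 < t -> heat_at v x t) ->
  (forall x t, 0 <= x -> 0 <= t -> u x t - v x t <= B) ->
  (forall x, 0 <= x -> u x 0 <= v x 0) ->
  (forall t, 0 <= t -> u 0 t <= v 0 t) ->
  forall x t, 0 <= x -> 0 <= t -> u x t <= v x t.
Proof.
move=> cu cv hu hv hB h0 hl x t x0 t0; rewrite -subr_le0.
apply: (@max_principle_halfline _ B (fun x t => u x t - v x t)) => //.
- exact: within_continuous_sub.
- by move=> y s y0 s0; apply: heat_at_sub; [exact: hu|exact: hv].
- by move=> y y0; rewrite subr_le0 h0.
- by move=> s s0; rewrite subr_le0 hl.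
Qed.

Lemma within_continuous_cst (A : set (R * R)) (c : R) :
  {within A, continuous (fun p : R * R => c)}.
Proof. by apply: continuous_subspaceT => p; exact: cst_continuous. Qed.

End Uniqueness.

(** * The solutions as heat flows of extended data *)

Section Representation.
Context {R : realType}.
Variables (R0 : R) (u0 : R -> R).
Hypotheses (R0_gt0 : 0 < R0) (hu0 : L1_datum R0 u0).
Implicit Types (w : R -> R -> R) (x t L : R).

Let N := L1_norm u0.
Let phi := odd_datum u0.

Lemma heat_halfline_at w x t : heat_halfline u0 w -> 0 < x -> 0 < t -> heat_at w x t.
Proof.
move=> hw x0 t0; apply: classical_heat_at (hh_classical hw) _ t0.
  exact: interval_open.
by rewrite /= in_itv/= x0.
Qed.

Lemma heat_interval_at L w x t : heat_interval u0 L w -> 0 < x < L -> 0 < t -> heat_at w x t.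
Proof.
move=> hw x0 t0; apply: classical_heat_at (hi_classical hw) _ t0.
  exact: interval_open.
by rewrite /= in_itv/=.
Qed.

Lemma halfline_left w t : heat_halfline u0 w -> 0 <= t -> w 0 t = 1.
Proof.
move=> hw; rewrite le_eqVlt => /predU1P[<-|]; last exact: hh_left hw _.
by rewrite (hh_init hw (lexx 0)) (hopf_cole_datum_le0 u0 (lexx 0)).
Qed.

Lemma interval_left L w t : 0 <= L -> heat_interval u0 L w -> 0 <= t -> w 0 t = 1.
Proof.
move=> L0 hw; rewrite le_eqVlt => /predU1P[<-|]; last exact: hi_left hw _.
by rewrite (hi_init hw) ?lexx// (hopf_cole_datum_le0 u0 (lexx 0)).
Qed.

Lemma interval_right L w t : R0 <= L -> heat_interval u0 L w -> 0 <= t -> w L t = expR (mass u0).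
Proof.
move=> R0L hw; rewrite le_eqVlt => /predU1P[<-|]; last exact: hi_right hw _.
rewrite (hi_init hw); last by rewrite lexx (le_trans (ltW R0_gt0)).
exact: (hopf_cole_datum_ge R0_gt0 hu0).
Qed.

Lemma expRN_norm_le1 : expR (- N) <= 1.
Proof.
have /andP[h _] := hopf_cole_datum_bounds hu0 0.
by rewrite (hopf_cole_datum_le0 u0 (lexx 0)) in h.
Qed.

(** Comparison with a constant solution. The division by [w] needs a lower bound free of x and t. *)
Lemma halfline_ge w x t : heat_halfline u0 w -> 0 <= x -> 0 <= t -> expR (- N) <= w x t.
Proof.
move=> hw; apply: (@heat_le_halfline _ (expR (- N)) (fun _ _ => expR (- N)) w).
- exact: within_continuous_cst.
- exact: hh_continuous hw.
- by move=> *; exact: heat_at_cst.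
- by move=> *; exact: heat_halfline_at.
- by move=> y s y0 s0; rewrite gerBl ltW// (hh_pos hw).
- move=> y y0; rewrite (hh_init hw y0).
  by have /andP[] := hopf_cole_datum_bounds hu0 y.
- by move=> s s0; rewrite (halfline_left hw s0); exact: expRN_norm_le1.
Qed.

Lemma interval_ge L w x t : R0 <= L -> heat_interval u0 L w -> 0 <= x <= L -> 0 <= t ->
  expR (- N) <= w x t.
Proof.
move=> R0L hw xL t0.
apply: (@heat_le_interval _ L t (fun _ _ => expR (- N)) w) => //.
- exact: within_continuous_cst.
- apply: continuous_subspaceW (hi_continuous hw) => -[y s] [/= -> ].
  by rewrite !in_itv/= andbT => /andP[->].
- by move=> *; exact: heat_at_cst.
- by move=> *; exact: heat_interval_at hw _ _.
- move=> y y0; rewrite (hi_init hw y0).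
  by have /andP[] := hopf_cole_datum_bounds hu0 y.
- move=> s s0; rewrite (interval_left _ hw s0) ?(le_trans (ltW R0_gt0))//.
  exact: expRN_norm_le1.
- move=> s s0; rewrite (interval_right R0L hw s0).
  by have /andP[] := mass_bounds R0_gt0 hu0.
- by rewrite t0 lexx.
Qed.

Lemma continuous_odd_datum w : heat_halfline u0 w -> continuous phi.
Proof.
move=> hw x; have c := continuous_hopf_cole_datum hw.
apply: cvgB; first exact: c.
by apply: continuous_cvg; [exact: c|apply: cvgN; exact: cvg_id].
Qed.

Lemma odd_datum_growth y : `|phi y| <= expR N * (1 + `|y|).
Proof.
apply: (le_trans (odd_datum_norm hu0 y)).
by rewrite ler_peMr ?expR_ge0// lerDl.
Qed.

Lemma heat_at_sub1 w x t : heat_at w x t -> heat_at (fun x t => w x t - 1) x t.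
Proof. by move=> h; apply: heat_at_sub h (heat_at_cst _ _ _). Qed.

Lemma halfline_representation w x t : heat_halfline u0 w -> 0 <= x -> 0 <= t ->
  w x t = 1 + heat phi x t.
Proof.
move=> hw x0 t0; have cphi := continuous_odd_datum hw.
have cw : {within `[0, +oo[ `*` `[0, +oo[, continuous (fun p : R * R => w p.1 p.2 - 1)}.
  exact: within_continuous_sub1 (hh_continuous hw).
have ch : {within `[0, +oo[ `*` `[0, +oo[, continuous (fun p : R * R => heat phi p.1 p.2)}.
  by apply: continuous_subspaceT; exact: (continuous_heat cphi odd_datum_growth).
have aw y s : 0 < y -> 0 < s -> heat_at (fun x t => w x t - 1) y s.
  by move=> y0 s0; apply/heat_at_sub1/heat_halfline_at.
have ah y s : 0 < y -> 0 < s -> heat_at (heat phi) y s.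
  by move=> _ s0; exact: (heat_at_heat y cphi odd_datum_growth s0).
have [B hB] := hh_bounded hw.
have bw y s : 0 <= y -> 0 <= s -> `|w y s - 1| <= B + 1.
  by move=> y0 s0; rewrite (le_trans (ler_normB _ _))// normr1 lerD2r hB.
have bh y s : `|heat phi y s| <= expR N.
  by apply: heat_bounded cphi _ => z; exact: (odd_datum_norm hu0).
have e0 y : 0 <= y -> w y 0 - 1 = heat phi y 0.
  by move=> y0; rewrite heat_init (hh_init hw y0) /phi odd_datum_ge0.
have el s : 0 <= s -> w 0 s - 1 = heat phi 0 s.
  move=> s0; rewrite (halfline_left hw s0) subrr.
  apply/esym/(heat_reflect _ cphi odd_datum_growth) => y.
  by rewrite sub0r add0r /phi odd_datumN addrC subrr mulr0.
have eq : w x t - 1 = heat phi x t.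
  apply/eqP; rewrite eq_le; apply/andP; split.
    apply: (@heat_le_halfline _ (B + 1 + expR N) (fun x t => w x t - 1) (heat phi)) => //.
    - by move=> y s y0 s0; rewrite (le_trans (ler_norm _))// (le_trans (ler_normB _ _))// lerD ?bw.
    - by move=> y /e0 ->.
    - by move=> s /el ->.
  apply: (@heat_le_halfline _ (expR N + (B + 1)) (heat phi) (fun x t => w x t - 1)) => //.
  - by move=> y s y0 s0; rewrite (le_trans (ler_norm _))// (le_trans (ler_normB _ _))// lerD ?bw.
  - by move=> y /e0 ->.
  - by move=> s /el ->.
by rewrite -eq addrC subrK.
Qed.

Let m := expR (mass u0) - 1.

Definition interval_datum L := periodic_extension phi L m.

Lemma interval_datum_growth L y : R0 < L ->
  `|interval_datum L y| <= expR N * (2 + L^-1) * (1 + `|y|).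
Proof.
move=> R0L; have L0 : 0 < L by exact: lt_trans R0L.
apply: (le_trans (periodic_extension_norm R0_gt0 R0L
  (fun x h => odd_datum_ge R0_gt0 hu0 h) (odd_datum_norm hu0) y)).
rewrite -mulrA ler_pM2l ?expR_gt0//.
have Li : 0 < L^-1 by rewrite invr_gt0.
by have := normr_ge0 y; nra.
Qed.

Lemma continuous_interval_datum L : R0 < L -> continuous phi -> continuous (interval_datum L).
Proof.
move=> R0L cphi; apply: (continuous_periodic_extension R0_gt0 R0L cphi (@odd_datumN _ u0)).
by move=> x; exact: (odd_datum_ge R0_gt0 hu0).
Qed.

(** Continuity of [phi] is a hypothesis, supplied later by the half-line solution; the interval
    solution gives it directly only within [0, L]. *)
Lemma interval_representation L w x t : R0 < L -> continuous phi -> heat_interval u0 L w ->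
  0 <= x <= L -> 0 <= t -> w x t = 1 + heat (interval_datum L) x t.
Proof.
move=> R0L cphi hw xL t0; have L0 : 0 < L by exact: lt_trans R0L.
have phi_ge y : R0 <= y -> phi y = m by exact: (odd_datum_ge R0_gt0 hu0).
have phiN := @odd_datumN _ u0 : forall y, phi (- y) = - phi y.
set f := interval_datum L; have cf : continuous f by exact: continuous_interval_datum.
have fB y : `|f y| <= expR N * (2 + L^-1) * (1 + `|y|) by exact: interval_datum_growth.
have cw : {within `[0, L] `*` `[0, t], continuous (fun p : R * R => w p.1 p.2 - 1)}.
  apply: within_continuous_sub1.
  apply: continuous_subspaceW (hi_continuous hw) => -[y s] [/= -> ].
  by rewrite !in_itv/= andbT => /andP[->].
have ch : {within `[0, L] `*` `[0, t], continuous (fun p : R * R => heat f p.1 p.2)}.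
  by apply: continuous_subspaceT; exact: (continuous_heat cf fB).
have aw y s : 0 < y < L -> 0 < s -> heat_at (fun x t => w x t - 1) y s.
  by move=> y0 s0; apply/heat_at_sub1/(heat_interval_at hw).
have ah y s : 0 < y < L -> 0 < s -> heat_at (heat f) y s.
  by move=> _ s0; exact: (heat_at_heat y cf fB s0).
have e0 y : 0 <= y <= L -> w y 0 - 1 = heat f y 0.
  move=> /[dup] y0L /andP[y0 yL]; rewrite heat_init (hi_init hw y0L) /f /interval_datum.
  rewrite (periodic_extension_near R0_gt0 R0L phiN phi_ge) ?/phi ?odd_datum_ge0//.
  by rewrite ger0_norm//; lra.
have el s : 0 <= s -> w 0 s - 1 = heat f 0 s.
  move=> s0; rewrite (interval_left (ltW L0) hw s0) subrr.
  apply/esym/(heat_reflect _ cf fB) => y.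
  rewrite sub0r add0r /f /interval_datum (periodic_extensionN R0_gt0 R0L phiN phi_ge).
  by rewrite addrC subrr mulr0.
have er s : 0 <= s -> w L s - 1 = heat f L s.
  move=> s0; rewrite (interval_right (ltW R0L) hw s0) -/m.
  apply/esym/(heat_reflect _ cf fB) => y.
  exact: (periodic_extension_reflect R0_gt0 R0L phiN phi_ge).
have t1 : 0 <= t <= t by rewrite t0 lexx.
have eq : w x t - 1 = heat f x t.
  apply/eqP; rewrite eq_le; apply/andP; split.
    apply: (@heat_le_interval _ L t (fun x t => w x t - 1) (heat f)) => //.
    - by move=> y /e0 ->.
    - by move=> s /el ->.
    - by move=> s /er ->.
  apply: (@heat_le_interval _ L t (heat f) (fun x t => w x t - 1)) => //.
  - by move=> y /e0 ->.
  - by move=> s /el ->.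
  - by move=> s /er ->.
by rewrite -eq addrC subrK.
Qed.

End Representation.

(** * Convolution at a distance from the support of the datum *)

Section ConvolutionBounds.
Context {R : realType}.
Notation mu := (@lebesgue_measure R).
Implicit Types (F : R -> R) (n k : nat).

(** The exponent (x - y)^2 / 4 is shared out: a part d goes to the polynomial factor, a part d is
    kept to integrate the linear growth, and 1 - 2 d is evaluated at the distance b. The constant
    precedes [F], [B] and [b], hence will not depend on L or c. *)
Lemma conv_bound n (d rho : R) : 0 < d ->
  exists2 C : R, 0 < C & forall F (B b : R), continuous F ->
    (forall y, `|F y| <= B * (1 + `|y|)) -> 0 <= b ->
    (forall x y, `|x| <= rho -> F y != 0 -> b <= `|x - y|) ->
    2 * d <= 1 ->
    forall x, `|x| <= rho ->
    `|conv n F x 1| <= C * B * expR (- ((1 - 2 * d) * (b ^+ 2 / 4))).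
Proof.
move=> d0; have [C1 C10 hC1] := heat_kernel_le n d0.
have d4 : 0 < d / 4 by rewrite divr_gt0.
have [C2 [K K0 [C20 hC2]]] := gauss_shift_le rho d4 (@ltr01 R) (@ltr01 R).
pose G := \int[mu]_y (1 * expR (- (K * y ^+ 2))).
have G0 : 0 <= G by apply: Rintegral_ge0 => y _; rewrite mul1r expR_ge0.
exists (C1 * C2 * (G + 1)); first by rewrite !mulr_gt0// ltr_wpDl.
move=> F B b cF FB b0 hb d1 x xr.
have B0 : 0 <= B by have := FB 0; rewrite normr0 addr0 mulr1; exact: le_trans.
set E := expR (- _).
have E0 : 0 <= E by exact: expR_ge0.
rewrite /conv invr1 mul1r.
have h y : `|heat_kernel n ((x - y) * 1) * F y| <= C1 * C2 * B * E * (1 * expR (- (K * y ^+ 2))).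
  have [->|Fy] := eqVneq (F y) 0.
    by rewrite mulr0 normr0 !mulr_ge0// ?expR_ge0// ltW.
  have by' := hb x y xr Fy.
  rewrite normrM mulr1 mul1r.
  have := hC2 x 1 y xr; rewrite lexx divr1 => /(_ isT) hy.
  have hk : `|heat_kernel n (x - y)| <= C1 * (E * expR (- (d / 4 * (x - y) ^+ 2))).
    apply: (le_trans (hC1 _)); rewrite ler_pM2l// /E -expRD ler_expR.
    have : b ^+ 2 <= (x - y) ^+ 2.
      by rewrite -(real_normK (num_real (x - y))) lerXn2r ?nnegrE// (le_trans b0).
    by nra.
  apply: (@le_trans _ _ (C1 * (E * expR (- (d / 4 * (x - y) ^+ 2))) * (B * (1 + `|y|)))).
    by rewrite ler_pM.
  rewrite (_ : C1 * (E * _) * _ = C1 * B * E * (expR (- (d / 4 * (x - y) ^+ 2)) * (1 + `|y|))); last by ring.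
  rewrite (_ : C1 * C2 * B * E * _ = C1 * B * E * (C2 * expR (- (K * y ^+ 2)))); last by ring.
  by rewrite ler_wpM2l// !mulr_ge0// ltW.
have ig := integrable_gauss 1 K0.
apply: le_trans (le_norm_Rintegral _ h _) _.
- rewrite (_ : (fun y => _) = (fun y => heat_kernel n ((x - y) / 1) * F y)).
    exact: measurable_conv_integrand.
  by apply/funext => y; rewrite divr1 mulr1.
- exact: integrable_scaleR.
rewrite RintegralZl// -/G.
rewrite (_ : C1 * C2 * B * E * G = C1 * C2 * G * (B * E)); last by ring.
rewrite (_ : C1 * C2 * (G + 1) * B * E = C1 * C2 * (G + 1) * (B * E)); last by ring.
by rewrite ler_wpM2r ?mulr_ge0// ler_wpM2l ?lerDl// mulr_ge0// ltW.
Qed.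

Lemma conv_bound_upto k (d rho : R) : 0 < d -> 2 * d <= 1 ->
  exists2 C : R, 0 < C & forall n F (B b : R), (n <= k)%N -> continuous F ->
    (forall y, `|F y| <= B * (1 + `|y|)) -> 0 <= b ->
    (forall x y, `|x| <= rho -> F y != 0 -> b <= `|x - y|) ->
    forall x, `|x| <= rho ->
    `|conv n F x 1| <= C * B * expR (- ((1 - 2 * d) * (b ^+ 2 / 4))).
Proof.
move=> d0 d1; elim: k => [|k [C C0 hC]].
  have [C C0 hC] := conv_bound 0 rho d0; exists C => // n F B b.
  by rewrite leqn0 => /eqP ->; move=> *; exact: hC.
have [C' C'0 hC'] := conv_bound k.+1 rho d0; exists (C + C'); first exact: addr_gt0.
move=> n F B b; rewrite leq_eqVlt => nk cF FB b0 hb x xr.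
have B0 : 0 <= B by have := FB 0; rewrite normr0 addr0 mulr1; exact: le_trans.
have E0 := expR_ge0 (- ((1 - 2 * d) * (b ^+ 2 / 4))).
move: nk => /orP[/eqP ->|nk].
  apply: le_trans (hC' F B b cF FB b0 hb d1 x xr) _.
  by rewrite !ler_wpM2r// lerDr ltW.
apply: le_trans (hC n F B b nk cF FB b0 hb x xr) _.
by rewrite !ler_wpM2r// lerDl ltW.
Qed.

Lemma Ck_bounded_conv k n F (a C B : R) : continuous F ->
  (forall y, `|F y| <= B * (1 + `|y|)) ->
  (forall j x, (n <= j <= n + k)%N -> 0 <= x <= a -> `|conv j F x 1| <= C) ->
  Ck_bounded a k C (fun x => conv n F x 1).
Proof.
move=> cF FB; elim: k n => [|k IH] n h.
  split=> [x Ix|x Ix]; first by apply: h; rewrite ?addn0 ?leqnn.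
  apply: differentiable_continuous; apply/derivable1_diffP.
  by have [] := is_derive_conv_x cF FB n x (@ltr01 R).
split; first by move=> x Ix; apply: h; rewrite ?leqnn ?leq_addr.
exists (fun x => conv n.+1 F x 1); split.
  by move=> x _; have := is_derive_conv_x cF FB n x (@ltr01 R); rewrite divr1.
apply: IH => j x /andP[nj jk]; apply: h.
by rewrite (ltnW nj)/= addnS -addSn.
Qed.

End ConvolutionBounds.

(** * The quotients w_x / w and their differences *)

Section DifferenceQuotient.
Context {R : realType}.
Implicit Types (f F : R -> R) (w : R -> R -> R) (x t : R).

Lemma conv_sub n F G (B B' x : R) : continuous F -> continuous G ->
  (forall y, `|F y| <= B * (1 + `|y|)) -> (forall y, `|G y| <= B' * (1 + `|y|)) ->
  conv n (fun y => F y - G y) x 1 = conv n F x 1 - conv n G x 1.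
Proof.
move=> cF cG FB GB; rewrite /conv -mulrBr -RintegralB//.
- by congr (_ * _); apply: eq_Rintegral => y _; rewrite mulrBr.
- exact: integrable_conv_integrand cF FB _ _ _ ltr01.
- exact: integrable_conv_integrand cG GB _ _ _ ltr01.
Qed.

Lemma heat_profile f (B x t : R) : continuous f -> (forall y, `|f y| <= B * (1 + `|y|)) ->
  0 < t -> heat f (Num.sqrt t * x) t = conv 0 (fun y => f (Num.sqrt t * y)) x 1.
Proof.
move=> cf fB t0; rewrite (heatE _ cf fB t0) (conv_scale _ _ cf fB)//.
by rewrite sqrtr_gt0.
Qed.

Lemma rescaled_hopf_cole w f (B x t : R) : continuous f ->
  (forall y, `|f y| <= B * (1 + `|y|)) -> 0 < t ->
  (\forall y \near Num.sqrt t * x, w y t = 1 + heat f y t) ->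
  rescaled (hopf_cole w) t x =
    conv 1 (fun y => f (Num.sqrt t * y)) x 1 / (1 + conv 0 (fun y => f (Num.sqrt t * y)) x 1).
Proof.
move=> cf fB t0 wE; have s0 : 0 < Num.sqrt t by rewrite sqrtr_gt0.
rewrite /rescaled /hopf_cole [x * _]mulrC (nbhs_singleton wE) (heat_profile _ cf fB t0).
rewrite mulrA; congr (_ / _); rewrite /dx derive1E.
have : is_derive (Num.sqrt t * x) 1 (fun y => w y t) (conv 1 f (Num.sqrt t * x) (Num.sqrt t) / Num.sqrt t).
  apply: (@near_eq_is_derive _ _ _ (fun y => conv 0 f y (Num.sqrt t) + 1)).
    by near=> y; rewrite addrC -(heatE _ cf fB t0); apply/esym; near: y.
  rewrite -[X in is_derive _ _ _ X]addr0; apply: is_deriveD.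
  exact: is_derive_conv_x cf fB _ _ _ s0.
move=> [_ ->]; rewrite mulrC divfK ?gt_eqF// (conv_scale _ _ cf fB)//.
Unshelve.
all: end_near.
Qed.

Definition quotient_bound k (B m : R) : R :=
  2 ^+ k * ((2 ^+ k * B + 2 ^+ k * B) * (2 ^+ k * (inverse_bound k B m * inverse_bound k B m))).

Lemma quotient_bound_ge0 k (B m : R) : 0 <= B -> 0 < m -> 0 <= quotient_bound k B m.
Proof.
move=> B0 m0; have i0 := inverse_bound_ge0 k B0 m0.
have p0 : 0 <= 2 ^+ k :> R by rewrite exprn_ge0.
by rewrite /quotient_bound mulr_ge0// mulr_ge0 ?addr_ge0 ?mulr_ge0.
Qed.

(** With A = w^oo, A + Z = w^L and A', Z' their space derivatives, this is the difference of the
    logarithmic derivatives over a common denominator. The numerator is linear in (Z, Z'), whence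
    the factor b. *)
Lemma Ck_bounded_quotient (a : R) k (B b m : R) (A A' Z Z' : R -> R) :
  0 <= B -> 0 <= b -> 0 < m ->
  (forall x, 0 <= x <= a -> m <= A x) -> (forall x, 0 <= x <= a -> m <= A x + Z x) ->
  Ck_bounded a k B A -> Ck_bounded a k B A' -> Ck_bounded a k B (fun x => A x + Z x) ->
  Ck_bounded a k b Z -> Ck_bounded a k b Z' ->
  Ck_bounded a k (quotient_bound k B m * b)
    (fun x => (Z' x * A x - A' x * Z x) * ((A x)^-1 * (A x + Z x)^-1)).
Proof.
move=> B0 b0 m0 Am Zm hA hA' hAZ hZ hZ'.
have i0 := inverse_bound_ge0 k B0 m0.
have p0 : 0 <= 2 ^+ k :> R by rewrite exprn_ge0.
rewrite (_ : quotient_bound k B m * b = 2 ^+ k * ((2 ^+ k * (b * B) + 2 ^+ k * (B * b)) *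
  (2 ^+ k * (inverse_bound k B m * inverse_bound k B m)))); last by rewrite /quotient_bound; ring.
apply: Ck_boundedM.
- by rewrite addr_ge0 ?mulr_ge0.
- by rewrite !mulr_ge0.
- by apply: Ck_boundedD; [exact: Ck_boundedM|apply: Ck_boundedN; exact: Ck_boundedM].
- by apply: Ck_boundedM => //; exact: Ck_boundedV.
Qed.

End DifferenceQuotient.

(** * The difference of the rescaled solutions *)

Section RescaledDifference.
Context {R : realType}.
Variables (R0 rho : R) (u0 : R -> R) (L c : R) (wL winf : R -> R -> R).
Hypotheses (R0_gt0 : 0 < R0) (rho_gt0 : 0 < rho) (hu0 : L1_datum R0 u0) (R0L : R0 < L)
  (hL : heat_interval u0 L wL) (hinf : heat_halfline u0 winf) (hc : 0 < c < 1 / rho ^+ 2).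

Let t := c * L ^+ 2.
Let s := Num.sqrt t.
Let N := L1_norm u0.

Definition scaled_datum y := odd_datum u0 (s * y).
Definition scaled_interval_datum y := interval_datum u0 L (s * y).
Definition scaled_difference y := scaled_interval_datum y - scaled_datum y.

Lemma length_gt0 : 0 < L. Proof. exact: lt_trans R0L. Qed.

Lemma ratio_gt0 : 0 < c. Proof. by case/andP: hc. Qed.

Lemma time_gt0 : 0 < t. Proof. by rewrite mulr_gt0 ?ratio_gt0// exprn_gt0 ?length_gt0. Qed.

Lemma sqrt_timeE : s = Num.sqrt c * L.
Proof.
rewrite /s /t sqrtrM ?(ltW ratio_gt0)// sqrtr_sqr ger0_norm//; exact: ltW length_gt0.
Qed.

Lemma sqrt_time_gt0 : 0 < s. Proof. by rewrite sqrtr_gt0 time_gt0. Qed.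

Lemma rho_sqrt_lt1 : rho * Num.sqrt c < 1.
Proof.
have /andP[c0] := hc; rewrite ltr_pdivlMr ?exprn_gt0// => h.
rewrite -(@ltr_pXn2r _ 2)// ?nnegrE ?mulr_ge0 ?sqrtr_ge0 ?ltW//.
by rewrite exprMn sqr_sqrtr ?ltW// expr1n mulrC.
Qed.

(** The condition c < 1 / rho^2 says exactly that rho sqrt t < L. *)
Lemma sqrt_time_mul_lt x : 0 <= x <= rho -> 0 <= s * x < L.
Proof.
move=> /andP[x0 xr]; rewrite mulr_ge0 ?(ltW sqrt_time_gt0)//= sqrt_timeE.
have h := rho_sqrt_lt1; have hL0 := length_gt0; have hs := sqrtr_ge0 c.
rewrite (@le_lt_trans _ _ (Num.sqrt c * L * rho))//; last by nra.
by rewrite ler_wpM2l ?mulr_ge0// ltW.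
Qed.

Lemma continuous_scaled_datum : continuous scaled_datum.
Proof. exact: continuous_scale (continuous_odd_datum hinf). Qed.

Lemma continuous_scaled_interval_datum : continuous scaled_interval_datum.
Proof.
by apply: continuous_scale; exact: (continuous_interval_datum R0_gt0 hu0 R0L (continuous_odd_datum hinf)).
Qed.

Lemma continuous_scaled_difference : continuous scaled_difference.
Proof.
by move=> x; apply: cvgB; [exact: continuous_scaled_interval_datum|exact: continuous_scaled_datum].
Qed.

(** The interval datum contributes e^N (2 + |y| / rho), as sqrt c < 1 / rho, and the half-line datum
    contributes e^N. *)
Definition growth_bound (n r : R) : R := expR n * (3 + r^-1).

Lemma growth_bound_gt0 : 0 < growth_bound N rho.
Proof. by rewrite mulr_gt0 ?expR_gt0// addr_gt0// invr_gt0. Qed.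

Lemma scaled_datum_growth y : `|scaled_datum y| <= growth_bound N rho * (1 + `|y|).
Proof.
apply: le_trans (odd_datum_norm hu0 _) _; rewrite /growth_bound -mulrA ler_peMr ?expR_ge0//.
have r0 : 0 < rho^-1 by rewrite invr_gt0.
by have := normr_ge0 y; nra.
Qed.

Lemma scaled_interval_datum_norm y : `|scaled_interval_datum y| <= expR N * (2 + rho^-1 * `|y|).
Proof.
apply: (le_trans (periodic_extension_norm R0_gt0 R0L
  (fun x h => odd_datum_ge R0_gt0 hu0 h) (odd_datum_norm hu0) _)).
rewrite ler_pM2l ?expR_gt0// lerD2l normrM (gtr0_norm sqrt_time_gt0) sqrt_timeE.
rewrite mulrAC mulfK ?gt_eqF ?length_gt0// ler_wpM2r//.
by rewrite -[rho^-1]mul1r ler_pdivlMr// mulrC ltW// rho_sqrt_lt1.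
Qed.

Lemma scaled_interval_datum_growth y :
  `|scaled_interval_datum y| <= growth_bound N rho * (1 + `|y|).
Proof.
apply: le_trans (scaled_interval_datum_norm y) _; rewrite /growth_bound -mulrA ler_pM2l ?expR_gt0//.
have r0 : 0 < rho^-1 by rewrite invr_gt0.
by have := normr_ge0 y; nra.
Qed.

Lemma scaled_difference_growth y : `|scaled_difference y| <= growth_bound N rho * (1 + `|y|).
Proof.
apply: le_trans (ler_normB _ _) _.
apply: (le_trans (lerD (scaled_interval_datum_norm y) (odd_datum_norm hu0 _))).
rewrite /growth_bound -[X in _ + X]mulr1 -mulrDr -[leRHS]mulrA ler_pM2l ?expR_gt0//.
have r0 : 0 < rho^-1 by rewrite invr_gt0.
by have := normr_ge0 y; nra.
Qed.

Lemma interval_profile x : 0 <= x <= rho ->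
  wL (s * x) t = 1 + conv 0 scaled_interval_datum x 1.
Proof.
move=> xr; have /andP[h1 h2] := sqrt_time_mul_lt xr.
rewrite (interval_representation R0_gt0 hu0 R0L (continuous_odd_datum hinf) hL); last 2 first.
  by rewrite h1 ltW.
  exact: ltW time_gt0.
rewrite (heat_profile _ (continuous_interval_datum R0_gt0 hu0 R0L (continuous_odd_datum hinf))
  (fun y => interval_datum_growth R0_gt0 hu0 y R0L))//.
exact: time_gt0.
Qed.

Lemma halfline_profile x : 0 <= x <= rho ->
  winf (s * x) t = 1 + conv 0 scaled_datum x 1.
Proof.
move=> xr; have /andP[h1 h2] := sqrt_time_mul_lt xr.
rewrite (halfline_representation hu0 hinf h1 (ltW time_gt0)).
rewrite (heat_profile _ (continuous_odd_datum hinf) (odd_datum_growth hu0))//.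
exact: time_gt0.
Qed.

Lemma conv_scaled_interval_datum n x : conv n scaled_interval_datum x 1 =
  conv n scaled_datum x 1 + conv n scaled_difference x 1.
Proof.
rewrite (conv_sub n x continuous_scaled_interval_datum continuous_scaled_datum
  scaled_interval_datum_growth scaled_datum_growth).
by rewrite addrC subrK.
Qed.

Lemma rescaled_interval x : x \in `]0, rho[ ->
  rescaled (hopf_cole wL) t x =
    conv 1 scaled_interval_datum x 1 / (1 + conv 0 scaled_interval_datum x 1).
Proof.
rewrite in_itv/= => /andP[x0 xr].
have /andP[h1 h2] : 0 <= s * x < L by apply: sqrt_time_mul_lt; rewrite !ltW.
have h3 : 0 < s * x by rewrite mulr_gt0 ?sqrt_time_gt0.
apply: (rescaled_hopf_cole (continuous_interval_datum R0_gt0 hu0 R0L (continuous_odd_datum hinf))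
  (fun y => interval_datum_growth R0_gt0 hu0 y R0L) time_gt0).
near=> y; apply: (interval_representation R0_gt0 hu0 R0L (continuous_odd_datum hinf) hL); last exact: ltW time_gt0.
by apply/andP; split; apply: ltW; near: y; [exact: lt_nbhsr|exact: lt_nbhsl].
Unshelve.
all: end_near.
Qed.

Lemma rescaled_halfline x : x \in `]0, rho[ ->
  rescaled (hopf_cole winf) t x = conv 1 scaled_datum x 1 / (1 + conv 0 scaled_datum x 1).
Proof.
rewrite in_itv/= => /andP[x0 xr].
have h3 : 0 < s * x by rewrite mulr_gt0 ?sqrt_time_gt0.
apply: (rescaled_hopf_cole (continuous_odd_datum hinf) (odd_datum_growth hu0) time_gt0).
near=> y; apply: (halfline_representation hu0 hinf); last exact: ltW time_gt0.
by apply: ltW; near: y; exact: lt_nbhsr.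
Unshelve.
all: end_near.
Qed.

Lemma halfline_profile_ge x : 0 <= x <= rho -> expR (- N) <= 1 + conv 0 scaled_datum x 1.
Proof.
move=> xr; have /andP[h1 h2] := sqrt_time_mul_lt xr; rewrite -halfline_profile//.
exact: (halfline_ge hu0 hinf h1 (ltW time_gt0)).
Qed.

Lemma interval_profile_ge x : 0 <= x <= rho -> expR (- N) <= 1 + conv 0 scaled_interval_datum x 1.
Proof.
move=> xr; have /andP[h1 h2] := sqrt_time_mul_lt xr; rewrite -interval_profile//.
apply: (interval_ge R0_gt0 hu0 (ltW R0L) hL) (ltW time_gt0).
by rewrite h1 ltW.
Qed.

Lemma rescaled_difference x : x \in `]0, rho[ ->
  rescaled (hopf_cole wL) t x - rescaled (hopf_cole winf) t x =
  (conv 1 scaled_difference x 1 * (1 + conv 0 scaled_datum x 1) -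
   conv 1 scaled_datum x 1 * conv 0 scaled_difference x 1) *
  ((1 + conv 0 scaled_datum x 1)^-1 *
   (1 + conv 0 scaled_datum x 1 + conv 0 scaled_difference x 1)^-1).
Proof.
move=> xr; rewrite rescaled_interval// rescaled_halfline//.
have Ix : 0 <= x <= rho by move: xr; rewrite in_itv/= => /andP[/ltW -> /ltW ->].
have := halfline_profile_ge Ix; have := interval_profile_ge Ix.
rewrite !conv_scaled_interval_datum => h1 h2.
have e0 := expR_gt0 (- N).
have n1 := lt0r_neq0 (lt_le_trans e0 h1).
have n2 := lt0r_neq0 (lt_le_trans e0 h2).
by rewrite addrA in n1 *; field; rewrite n1 n2.
Qed.

(** The data agree for sqrt t |y| <= 2 L - R0, that is for |y| <= (2 - R0 / L) / sqrt c; [rho] is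
    subtracted to measure from any x with |x| <= rho. *)
Definition support_gap := (2 - R0 / L) / Num.sqrt c - rho.

Lemma sqrt_ratio_gt0 : 0 < Num.sqrt c. Proof. by rewrite sqrtr_gt0 ratio_gt0. Qed.

Lemma support_ratio_lt1 : R0 / L < 1. Proof. by rewrite ltr_pdivrMr ?length_gt0// mul1r. Qed.

Lemma support_gap_ge0 : 0 <= support_gap.
Proof.
rewrite /support_gap subr_ge0 ler_pdivlMr ?sqrt_ratio_gt0//.
by have := rho_sqrt_lt1; have := support_ratio_lt1; lra.
Qed.

Lemma scaled_difference_support x y : `|x| <= rho -> scaled_difference y != 0 ->
  support_gap <= `|x - y|.
Proof.
move=> xr; apply: contraNT; rewrite -ltNge => xy.
have hL0 := length_gt0; have hs := sqrt_ratio_gt0.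
rewrite subr_eq0 /scaled_interval_datum /interval_datum (periodic_extension_near R0_gt0 R0L)//.
- by move=> z; rewrite odd_datumN.
- by move=> z; exact: (odd_datum_ge R0_gt0 hu0).
rewrite normrM (gtr0_norm sqrt_time_gt0) sqrt_timeE.
have : `|y| < (2 - R0 / L) / Num.sqrt c.
  rewrite -(subrK x y) (le_lt_trans (ler_normD _ _))// distrC.
  by move: xy; rewrite /support_gap; lra.
rewrite ltr_pdivlMr// => hy.
rewrite (_ : 2 * L - R0 = (2 - R0 / L) * L); last by field; rewrite gt_eqF.
by rewrite mulrAC ler_pM2r// mulrC ltW.
Qed.

(** Up to a constant, R0 / L and the term in rho / sqrt c each cost a quarter of eps, so the squared
    gap over 4 is at least (1 - eps / 2) / c; the kernel leaves another factor 1 - eps / 2, and (1 -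
    eps / 2)^2 >= 1 - eps. *)
Lemma exp_support_gap (eps : R) : 0 < eps < 1 -> R0 / L <= eps / 4 ->
  expR (- ((1 - 2 * (eps / 4)) * (support_gap ^+ 2 / 4))) <=
  expR (rho ^+ 2 / eps) * expR (- ((1 - eps) / c)).
Proof.
move=> /andP[e0 e1] hr; rewrite -expRD ler_expR.
pose q := (Num.sqrt c)^-1.
have q0 : 0 < q by rewrite invr_gt0 sqrt_ratio_gt0.
have qc : q ^+ 2 = c^-1 by rewrite exprVn sqr_sqrtr// ltW// ratio_gt0.
pose r := R0 / L.
have r0 : 0 <= r by rewrite divr_ge0// ltW// length_gt0.
have h1 : support_gap ^+ 2 / 4 >= (1 - eps / 4) * q ^+ 2 - rho * q.
  rewrite /support_gap -/q -/r.
  have hr0 := rho_gt0.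
  have : 0 <= r ^+ 2 * q ^+ 2 by rewrite mulr_ge0 ?sqr_ge0.
  have : 0 <= (eps / 4 - r) * q ^+ 2 by rewrite mulr_ge0 ?sqr_ge0// subr_ge0.
  have : 0 <= r * (rho * q) by rewrite mulr_ge0// mulr_ge0// ltW.
  have : 0 <= rho ^+ 2 by rewrite sqr_ge0.
  rewrite (_ : ((2 - r) * q - rho) ^+ 2 / 4 = q ^+ 2 - r * q ^+ 2 + (r ^+ 2 * q ^+ 2) / 4
    - rho * q + r * (rho * q) / 2 + rho ^+ 2 / 4); last by field.
  lra.
(* Young's inequality: eps times the difference of the sides is (eps q / 2 - rho)^2. This is the
   origin of e^(rho^2 / eps). *)
have h2 : rho * q <= eps / 4 * q ^+ 2 + rho ^+ 2 / eps.
  rewrite -subr_ge0 -(pmulr_rge0 _ e0).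
  rewrite [leRHS](_ : _ = (eps / 2 * q - rho) ^+ 2) ?sqr_ge0//.
  by field; rewrite gt_eqF.
have h3 : support_gap ^+ 2 / 4 >= (1 - eps / 2) * q ^+ 2 - rho ^+ 2 / eps by lra.
have h4 : 0 <= rho ^+ 2 / eps by rewrite divr_ge0 ?sqr_ge0// ltW.
rewrite -[(1 - eps) / c]/((1 - eps) * c^-1) -qc.
have q2 : 0 <= q ^+ 2 by rewrite sqr_ge0.
have h5 : (1 - eps / 2) * (support_gap ^+ 2 / 4) >= (1 - eps / 2) * ((1 - eps / 2) * q ^+ 2 - rho ^+ 2 / eps).
  by rewrite ler_wpM2l//; lra.
rewrite (_ : 1 - 2 * (eps / 4) = 1 - eps / 2); last by field.
nra.
Qed.

(** The bound on convolutions is a hypothesis on [C], so that [C] can be fixed before the datum, L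
    and c. *)
Lemma rescaled_difference_bounded k (eps C : R) : 0 < eps < 1 -> R0 / L <= eps / 4 -> 0 < C ->
  (forall n F (B b : R), (n <= k.+1)%N -> continuous F ->
    (forall y, `|F y| <= B * (1 + `|y|)) -> 0 <= b ->
    (forall x y, `|x| <= rho -> F y != 0 -> b <= `|x - y|) ->
    forall x, `|x| <= rho ->
    `|conv n F x 1| <= C * B * expR (- ((1 - 2 * (eps / 4)) * (b ^+ 2 / 4)))) ->
  exists2 d, {in `]0, rho[, forall x,
      rescaled (hopf_cole wL) t x - rescaled (hopf_cole winf) t x = d x} &
    Ck_bounded rho k (quotient_bound k (1 + C * growth_bound N rho) (expR (- N)) *
      (C * growth_bound N rho * (expR (rho ^+ 2 / eps) * expR (- ((1 - eps) / c))))) d.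
Proof.
move=> he hr C0 hC.
have G0 := growth_bound_gt0.
have CG0 : 0 < C * growth_bound N rho by rewrite mulr_gt0.
have Ix x : 0 <= x <= rho -> `|x| <= rho by move=> /andP[x0 xr]; rewrite ger0_norm.
have b1 F n x : continuous F -> (forall y, `|F y| <= growth_bound N rho * (1 + `|y|)) ->
    (n <= k.+1)%N -> 0 <= x <= rho -> `|conv n F x 1| <= C * growth_bound N rho.
  move=> cF FB nk /Ix xr.
  (* The distance b = 0 asks nothing of the support. *)
  have := hC n F _ 0 nk cF FB (lexx 0) (fun x y _ _ => normr_ge0 _) x xr.
  by rewrite expr0n/= mul0r mulr0 oppr0 expR0 mulr1.
have hd n x : (n <= k.+1)%N -> 0 <= x <= rho -> `|conv n scaled_difference x 1| <=
    C * growth_bound N rho * (expR (rho ^+ 2 / eps) * expR (- ((1 - eps) / c))).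
  move=> nk /Ix xr.
  have := hC n _ _ _ nk continuous_scaled_difference scaled_difference_growth
    support_gap_ge0 scaled_difference_support x xr.
  by move=> /le_trans; apply; rewrite ler_wpM2l ?(ltW CG0)// exp_support_gap.
set b := C * growth_bound N rho * _ in hd *.
have b0 : 0 <= b by rewrite mulr_ge0 ?(ltW CG0)// mulr_ge0// expR_ge0.
have Bcst : Ck_bounded rho k 1 (fun=> 1 : R) by apply: Ck_bounded_cst; rewrite normr1.
have ck n F : (n <= 1)%N -> continuous F -> (forall y, `|F y| <= growth_bound N rho * (1 + `|y|)) ->
    Ck_bounded rho k (C * growth_bound N rho) (fun x => conv n F x 1).
  move=> n1 cF FB; apply: (Ck_bounded_conv cF FB) => j x /andP[_ jk] xr.
  by apply: b1 => //; rewrite (leq_trans jk)// -add1n leq_add2r.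
have ckd n : (n <= 1)%N -> Ck_bounded rho k b (fun x => conv n scaled_difference x 1).
  move=> n1; apply: (Ck_bounded_conv continuous_scaled_difference scaled_difference_growth).
  by move=> j x /andP[_ jk] xr; apply: hd => //; rewrite (leq_trans jk)// -add1n leq_add2r.
exists (fun x => (conv 1 scaled_difference x 1 * (1 + conv 0 scaled_datum x 1) -
   conv 1 scaled_datum x 1 * conv 0 scaled_difference x 1) *
  ((1 + conv 0 scaled_datum x 1)^-1 *
   (1 + conv 0 scaled_datum x 1 + conv 0 scaled_difference x 1)^-1)).
  by move=> x xr; exact: rescaled_difference.
apply: (@Ck_bounded_quotient _ rho k (1 + C * growth_bound N rho) b (expR (- N))
  (fun x => 1 + conv 0 scaled_datum x 1) (fun x => conv 1 scaled_datum x 1)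
  (fun x => conv 0 scaled_difference x 1) (fun x => conv 1 scaled_difference x 1)) => //.
- by rewrite addr_ge0// ltW.
- exact: expR_gt0.
- by move=> x; exact: halfline_profile_ge.
- by move=> x /interval_profile_ge; rewrite conv_scaled_interval_datum addrA.
- apply: Ck_boundedD => //; apply: ck => //.
    exact: continuous_scaled_datum.
  exact: scaled_datum_growth.
- apply: (@Ck_bounded_le _ _ _ (C * growth_bound N rho)); first by rewrite lerDr.
  apply: ck => //; first exact: continuous_scaled_datum.
  exact: scaled_datum_growth.
- rewrite (_ : (fun x => _) = (fun x => 1 + conv 0 scaled_interval_datum x 1)); last first.
    by apply/funext => x; rewrite conv_scaled_interval_datum addrA.
  apply: Ck_boundedD => //; apply: ck => //.
    exact: continuous_scaled_interval_datum.
  exact: scaled_interval_datum_growth.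
- exact: ckd.
- exact: ckd.
Qed.

(** The ratio g = w^L / w^oo is 1 at 0 by the boundary conditions, at most K e^N, and g' / g = v^L -
    v^oo. The mean value theorem bounds g - 1, and the difference of the solutions is w^oo (g -
    1). *)
Lemma conv_difference_le (K D x1 : R) : 0 < x1 < rho ->
  (forall x, 0 <= x <= rho -> `|1 + conv 0 scaled_datum x 1| <= K) ->
  (forall x, 0 <= x <= rho -> `|1 + conv 0 scaled_interval_datum x 1| <= K) ->
  (forall x, x \in `]0, rho[ ->
    `|rescaled (hopf_cole wL) t x - rescaled (hopf_cole winf) t x| <= D) ->
  `|conv 0 scaled_difference x1 1| <= K * (K * expR N * D * x1).
Proof.
move=> /andP[x10 x1r] hA hA1 hD.
pose A x := 1 + conv 0 scaled_datum x 1.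
pose A1 x := 1 + conv 0 scaled_interval_datum x 1.
have dA (x : R) : is_derive x (1 : R) A (conv 1 scaled_datum x 1).
  rewrite /A -[X in is_derive _ _ _ X]add0r; apply: is_deriveD.
  rewrite -[X in is_derive _ _ _ X]divr1.
  exact: (is_derive_conv_x continuous_scaled_datum scaled_datum_growth _ _ ltr01).
have dA1 (x : R) : is_derive x (1 : R) A1 (conv 1 scaled_interval_datum x 1).
  rewrite /A1 -[X in is_derive _ _ _ X]add0r; apply: is_deriveD.
  rewrite -[X in is_derive _ _ _ X]divr1.
  exact: (is_derive_conv_x continuous_scaled_interval_datum scaled_interval_datum_growth _ _ ltr01).
have e0 := expR_gt0 (- N).
have Ax x : 0 <= x <= rho -> expR (- N) <= A x by exact: halfline_profile_ge.
have A1x x : 0 <= x <= rho -> expR (- N) <= A1 x by exact: interval_profile_ge.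
have nA x : 0 <= x <= rho -> A x != 0 by move=> /Ax h; rewrite gt_eqF// (lt_le_trans e0).
have nA1 x : 0 <= x <= rho -> A1 x != 0 by move=> /A1x h; rewrite gt_eqF// (lt_le_trans e0).
pose g x := A1 x * (A x)^-1.
pose dg x := A1 x * (A x)^-1 * (conv 1 scaled_interval_datum x 1 / A1 x - conv 1 scaled_datum x 1 / A x).
have hg (x : R) : 0 <= x <= rho -> is_derive x (1 : R) g (dg x).
  move=> xr; apply: is_derive_eq (is_deriveM (dA1 x) (is_deriveV (nA x xr) (dA x))) _.
  by rewrite /dg /GRing.scale/=; field; rewrite nA// nA1.
have z0 : 0 <= (0 : R) <= rho by rewrite lexx ltW.
have A0 : A 0 = 1.
  by rewrite /A -halfline_profile// mulr0 (halfline_left hinf (ltW time_gt0)).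
have A10 : A1 0 = 1.
  by rewrite /A1 -interval_profile// mulr0 (interval_left (ltW length_gt0) hL (ltW time_gt0)).
have oI x : x \in `[0, x1] -> 0 <= x <= rho.
  by rewrite in_itv/= => /andP[-> /le_trans ->]//; exact: ltW.
have [||z zx] := @MVT _ g dg 0 x1 x10.
- by move=> x /subset_itv_oo_cc /oI; exact: hg.
- by apply: derivable_within_continuous => x /oI /hg[].
rewrite /g A0 A10 invr1 mulr1 subr0 => e.
have zr : z \in `]0, rho[.
  by move: zx; rewrite !in_itv/= => /andP[-> /lt_trans ->].
have Iz : 0 <= z <= rho by move: zr; rewrite in_itv/= => /andP[/ltW -> /ltW ->].
have Ix : 0 <= x1 <= rho by rewrite !ltW.
have D0 : 0 <= D by exact: le_trans (hD z zr).
have K0 : 0 <= K by exact: le_trans (hA 0 z0).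
have hdg : `|dg z| <= K * expR N * D.
  rewrite /dg normrM -(rescaled_interval zr) -(rescaled_halfline zr).
  rewrite ler_pM// ?hD// normrM ler_pM// ?hA1//.
  have Az := Ax z Iz; rewrite ger0_norm ?invr_ge0 ?(le_trans (ltW e0))//.
  by rewrite -[expR N]invrK -expRN lef_pV2 ?posrE// (lt_le_trans e0).
have -> : conv 0 scaled_difference x1 1 = A x1 * (A1 x1 / A x1 - 1).
  rewrite mulrBr mulr1 mulrCA mulfV ?nA// mulr1 /A1 /A conv_scaled_interval_datum.
  by ring.
rewrite normrM ler_pM//; first exact: hA.
by rewrite e normrM (gtr0_norm x10) ler_pM2r.
Qed.

End RescaledDifference.

(** * The limit of large L at a fixed ratio c, and the lower bound *)

Section Optimality.
Context {R : realType}.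
Notation mu := (@lebesgue_measure R).

(* [period_index] for [L = 1] and the limit of [periodic_extension phi L m (L r) - phi (L r)],
   divided by [m], as [L] tends to infinity. *)
Definition step_index (r : R) : int := period_index 1 r.

Definition step (r : R) : R :=
  2 * (step_index r)%:~R + Num.sg (r - 2 * (step_index r)%:~R) - Num.sg r.

Lemma period_index_scale (L r : R) : 0 < L -> period_index L (L * r) = step_index r.
Proof.
move=> L0; rewrite /step_index /period_index; congr Num.floor.
by field; rewrite gt_eqF.
Qed.

Lemma step_indexP (r : R) : -1 <= r - 2 * (step_index r)%:~R < 1.
Proof.
by have := period_indexP r (@ltr01 R); rewrite mulr1.
Qed.

Lemma sg_bounds (r : R) : -1 <= Num.sg r <= 1.
Proof. by case: sgrP => _; apply/andP; split; lra. Qed.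

Lemma step_ge0 (r : R) : 0 <= r -> 0 <= step r.
Proof.
move=> r0; have /andP[h1 h2] := step_indexP r; rewrite /step.
set q := step_index r in h1 h2 *.
have q0 : (-1 : R) < q%:~R by lra.
have {q0} : -1 < q by rewrite -(ltr_int R).
have /andP[s1 s2] := sg_bounds r; have /andP[s3 s4] := sg_bounds (r - 2 * q%:~R).
have [->|q1] := eqVneq q 0; first by rewrite mulr0 subr0 add0r subrr.
move=> qm; have {qm}q1 : 1 <= q by lia.
have : (1 : R) <= q%:~R by rewrite ler1z.
lra.
Qed.

(** For the index 1 both signs are 1 and cancel; an index of at least 2 contributes 4, of which the
    signs take away at most 2. *)
Lemma step_ge2 (r : R) : 2 < r -> 2 <= step r.
Proof.
move=> r2; have /andP[h1 h2] := step_indexP r; rewrite /step.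
set q := step_index r in h1 h2 *.
have q0 : (0 : R) < q%:~R by lra.
have {q0} : 0 < q by rewrite -(ltr_int R).
have /andP[s1 s2] := sg_bounds r; have /andP[s3 s4] := sg_bounds (r - 2 * q%:~R).
have [->|q1] := eqVneq q 1.
  by move=> _; rewrite !gtr0_sg; lra.
move=> qm; have {qm}q1 : 2 <= q by lia.
have : (2 : R) <= q%:~R by rewrite -[2]/(2%:~R) ler_int.
lra.
Qed.

Section Limit.
Variables (phi : R -> R) (R0 m : R).
Hypotheses (R0_gt0 : 0 < R0)
  (phiN : forall x, phi (- x) = - phi x) (phi_ge : forall x, R0 <= x -> phi x = m).
Variable L : nat -> R.
Hypotheses (L0 : forall n, 0 < L n) (Loo : L @ \oo --> +oo).

(** The sequence is eventually constant, once L n |r| passes R0; at r = 0 oddness gives 0. *)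
Lemma cvg_phi_scale (r : R) : (fun n => phi (L n * r)) @ \oo --> m * Num.sg r.
Proof.
have pos (a : R) : 0 < a -> \forall n \near \oo, R0 <= L n * a.
  move=> a0; have /cvgryPge/(_ (R0 / a)) := Loo.
  by apply: filterS => n; rewrite ler_pdivrMr.
apply: cvg_near_cst; case: sgrP => hr.
- by apply: nearW => n; rewrite hr mulr0 mulr0; have := phiN 0; rewrite oppr0 => h; apply/eqP; lra.
- by have := pos r hr; apply: filterS => n h; rewrite mulr1 phi_ge.
- have := pos (- r); rewrite oppr_gt0 => /(_ hr); apply: filterS => n h.
  by rewrite mulrN1 -[L n * r]opprK phiN -mulrN phi_ge.
Qed.

Lemma cvg_extension_difference (r : R) :
  (fun n => periodic_extension phi (L n) m (L n * r) - phi (L n * r)) @ \oo --> m * step r.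
Proof.
rewrite /step; set q : R := (step_index r)%:~R.
rewrite (_ : (fun n => _) = (fun n => 2 * m * q + phi (L n * (r - 2 * q)) - phi (L n * r))); last first.
  apply/funext => n; rewrite /periodic_extension period_index_scale// -/q.
  by congr (_ + phi _ - _); ring.
rewrite (_ : m * _ = 2 * m * q + m * Num.sg (r - 2 * q) - m * Num.sg r); last by ring.
by apply: cvgB; [apply: cvgD; [exact: cvg_cst|exact: cvg_phi_scale]|exact: cvg_phi_scale].
Qed.

End Limit.

Lemma conv1E n (F : R -> R) (x : R) :
  conv n F x 1 = \int[mu]_y (heat_kernel n ((x - y) / 1) * F y).
Proof. by rewrite /conv [X in X * _]invr1 mul1r. Qed.

Lemma conv0_odd (F : R -> R) (B x : R) : continuous F ->
  (forall y, `|F y| <= B * (1 + `|y|)) -> (forall y, F (- y) = - F y) ->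
  conv 0 F (- x) 1 = - conv 0 F x 1.
Proof.
move=> cF FB oF; rewrite /conv -mulrN; congr (_ * _).
rewrite -(Rintegral_oppr (@continuous_conv_integrand R 0 F (- x) 1 cF)) -mulN1r.
rewrite -RintegralZl//; last exact: (integrable_conv_integrand cF FB 0 x ltr01).
apply: eq_Rintegral => y _; rewrite oF mulrN mulN1r -heat_kernel0_even.
by congr (- (heat_kernel 0 _ * _)); rewrite !divr1; ring.
Qed.

(** Since (a + x1)^2 >= a^2 + 2 a x1, and e^(a x1 / 2) >= 1 + a x1 / 2 >= 2. *)
Lemma heat_kernel0_half (a x1 : R) : 0 < a -> 0 < x1 -> 2 <= a * x1 ->
  heat_kernel 0 (a + x1) <= heat_kernel 0 a / 2.
Proof.
move=> a0 x10 ax; rewrite /heat_kernel/= !hornerC -[leRHS]mulrA ler_wpM2l ?normal_peak_ge0//.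
apply: (@le_trans _ _ (expR (- (a ^+ 2 / 4)) * expR (- (a * x1 / 2)))).
  by rewrite -expRD ler_expR; have := sqr_ge0 x1; nra.
rewrite ler_pM2l ?expR_gt0// expRN lef_pV2 ?posrE ?expR_gt0//.
by have := expR_ge1Dx (a * x1 / 2); lra.
Qed.

Lemma Rintegral_ge_itv (f : R -> R) (a b v : R) : 0 <= v -> a <= b ->
  mu.-integrable setT (EFin \o f) ->
  (forall y, 0 <= f y) -> (forall y, a < y <= b -> v <= f y) ->
  v * (b - a) <= \int[mu]_y f y.
Proof.
move=> v0 ab fi f0 fv.
have muA : mu (`]a, b]%classic : set R) = (b - a)%:E.
  rewrite lebesgue_measure_itv/= lte_fin.
  by case: ltgtP ab => // -> _; rewrite subrr.
have fE : cst v \_ `]a, b] = (fun y : R => v * \1_(`]a, b]%classic : set R) y).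
  by apply/funext => y; rewrite /patch indicE; case: ifP; rewrite ?mulr1 ?mulr0.
have cst_ge0 y : 0 <= (cst v \_ `]a, b]) y by rewrite /patch; case: ifP.
have cst_le y : (cst v \_ `]a, b]) y <= f y.
  rewrite /patch; case: ifPn => [|_]; last exact: f0.
  by rewrite inE/= in_itv/= => /fv.
have -> : v * (b - a) = \int[mu]_y (cst v \_ `]a, b]) y.
  by rewrite -Rintegral_mkcond Rintegral_cst//; congr (v * _); rewrite -[LHS]/(fine (b - a)%:E) -muA.
apply: le_Rintegral => //.
apply: le_integrableR fi; last by move=> y; rewrite ger0_norm.
by rewrite fE; apply: measurable_funM.
Qed.

Lemma cvgn_opp_eq (u v : nat -> R) (a b : R) : u @ \oo --> a -> v @ \oo --> b ->
  (forall n, v n = - u n) -> b = - a.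
Proof.
move=> ua vb vu; rewrite -(cvg_lim _ vb)//; apply: cvg_lim => //.
by rewrite (_ : v = (fun n => - u n)); [exact: cvgN|apply/funext].
Qed.

Lemma cvgn_norm_le (u : nat -> R) (a D : R) : u @ \oo --> a ->
  (forall n, `|u n| <= D) -> `|a| <= D.
Proof.
move=> ua uD; have h : (fun n => `|u n|) @ \oo --> `|a| by exact: cvg_norm.
by apply: (cvgr_to_le h); exact: nearW.
Qed.

Section FixedRatio.
Variables (R0 rho : R) (u0 : R -> R) (winf : R -> R -> R) (c : R) (L : nat -> R).
Hypotheses (R0_gt0 : 0 < R0) (rho_gt0 : 0 < rho) (hu0 : L1_datum R0 u0)
  (hinf : heat_halfline u0 winf) (hc : 0 < c < 1 / rho ^+ 2)
  (R0L : forall n, R0 < L n) (Loo : L @ \oo --> +oo).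

Let m := expR (mass u0) - 1.
Let H n := scaled_difference u0 (L n) c.
Let S y := step (Num.sqrt c * y).

Let cH n : continuous (H n).
Proof. exact: (continuous_scaled_difference R0_gt0 hu0 (R0L n) hinf). Qed.

Let HB n y : `|H n y| <= growth_bound (L1_norm u0) rho * (1 + `|y|).
Proof. exact: (scaled_difference_growth R0_gt0 rho_gt0 hu0 (R0L n) hc). Qed.

Let phi_ge y : R0 <= y -> odd_datum u0 y = m.
Proof. exact: (odd_datum_ge R0_gt0 hu0). Qed.

Let H_odd n y : H n (- y) = - H n y.
Proof.
rewrite /H /scaled_difference /scaled_interval_datum /interval_datum /scaled_datum mulrN.
rewrite (periodic_extensionN R0_gt0 (R0L n) (@odd_datumN _ u0) phi_ge) odd_datumN.
by ring.
Qed.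

Let L0 n : 0 < L n. Proof. exact: lt_trans (R0L n). Qed.

Let cvgH y : (fun n => H n y) @ \oo --> m * S y.
Proof.
have h := cvg_extension_difference (@odd_datumN _ u0) phi_ge L0 Loo (r := Num.sqrt c * y).
rewrite (_ : (fun n => H n y) = (fun n => periodic_extension (odd_datum u0) (L n) m (L n * (Num.sqrt c * y)) -
  odd_datum u0 (L n * (Num.sqrt c * y)))); first exact: h.
apply/funext => n; rewrite /H /scaled_difference /scaled_interval_datum /interval_datum /scaled_datum.
by rewrite (sqrt_timeE R0_gt0 (R0L n) hc) [_ * L n]mulrC -mulrA.
Qed.

(** Inherited from the odd functions [H n], which avoids a discussion of [step] at its jumps. *)
Let S_odd y : m * S (- y) = - (m * S y).
Proof.
exact: (cvgn_opp_eq (@cvgH y) (@cvgH (- y)) (fun n => H_odd n y)).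
Qed.

Let cvg_convH x : mu.-integrable setT (EFin \o (fun y => heat_kernel 0 ((x - y) / 1) * (m * S y))) /\
  (fun n => conv 0 (H n) x 1) @ \oo --> \int[mu]_y (heat_kernel 0 ((x - y) / 1) * (m * S y)).
Proof.
have GB (y : R) : `|growth_bound (L1_norm u0) rho * (1 + `|y|)| <= growth_bound (L1_norm u0) rho * (1 + `|y|).
  by rewrite ger0_norm// mulr_ge0 ?addr_ge0// ltW// growth_bound_gt0.
have [g ig hg] := conv_integrand_le GB 0 `|x| (@ltr01 R) (@ltr01 R).
have [||||i h] := @Rintegral_cvg _ (fun n y => heat_kernel 0 ((x - y) / 1) * H n y)
  (fun y => heat_kernel 0 ((x - y) / 1) * (m * S y)) g.
- by move=> n; exact: measurable_conv_integrand.
- by move=> y; apply: cvgM; [exact: cvg_cst|exact: cvgH].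
- exact: ig.
- move=> n y; have := hg x 1 y (lexx _); rewrite lexx => /(_ isT); apply: le_trans.
  by rewrite normrM [leRHS]normrM ler_wpM2l//; exact: le_trans (HB n y) (ler_norm _).
split; first exact: i.
have -> : (fun n => conv 0 (H n) x 1) =
    (fun n => \int[mu]_y (heat_kernel 0 ((x - y) / 1) * H n y)).
  by apply/funext => n; exact: conv1E.
exact: h.
Qed.

(** By oddness, twice the limit at x1 is m times the integral of (G (y - x1) - G (y + x1)) S y, a
    product of two odd functions that are nonnegative for y >= 0. It may thus be bounded below on
    one interval from a = 2 / sqrt c to a + x1, where S >= 2 and the kernel is at least G a / 2.
    Finally G a is a multiple of e^(-1/c). *)
Lemma limit_difference_ge (x1 D : R) : 0 < x1 < rho -> Num.sqrt c <= x1 ->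
  (forall n, `|conv 0 (H n) x1 1| <= D) ->
  `|m| * x1 * heat_kernel 0 (2 / Num.sqrt c) <= 2 * D.
Proof.
move=> /andP[x10 x1r] cx hD.
have [m0|m0] := eqVneq m 0.
  by rewrite m0 normr0 !mul0r mulr_ge0// (le_trans _ (hD 0%N)).
have q0 : 0 < Num.sqrt c by rewrite sqrtr_gt0; case/andP: hc.
pose a := 2 / Num.sqrt c.
have a0 : 0 < a by rewrite divr_gt0.
have [i1 l1] := cvg_convH x1; have [i2 l2] := cvg_convH (- x1).
set I1 := \int[mu]_y _ in l1; set I2 := \int[mu]_y _ in l2.
have I21 : I2 = - I1.
  apply: (cvgn_opp_eq l1 l2) => n.
  exact: (conv0_odd x1 (@cH n) (HB n) (H_odd n)).
have I1D : `|I1| <= D by exact: (cvgn_norm_le l1 hD).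
pose k y := heat_kernel 0 ((x1 - y) / 1) - heat_kernel 0 ((- x1 - y) / 1).
have kE y : k y = heat_kernel 0 (y - x1) - heat_kernel 0 (y + x1).
  rewrite /k !divr1 -(heat_kernel0_even (y - x1)) -(heat_kernel0_even (y + x1)).
  by congr (heat_kernel 0 _ - heat_kernel 0 _); ring.
have ikm : mu.-integrable setT (EFin \o (fun y => k y * (m * S y))).
  rewrite (_ : (fun y => k y * (m * S y)) = (fun y => heat_kernel 0 ((x1 - y) / 1) * (m * S y) +
    (-1) * (heat_kernel 0 ((- x1 - y) / 1) * (m * S y)))).
    by apply: integrable_addR => //; exact: integrable_scaleR.
  by apply/funext => y; rewrite /k; ring.
have ikS : mu.-integrable setT (EFin \o (fun y => k y * S y)).
  rewrite (_ : (fun y => k y * S y) = (fun y => m^-1 * (k y * (m * S y)))); first exact: integrable_scaleR.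
  by apply/funext => y; field.
have e2 : 2 * I1 = m * \int[mu]_y (k y * S y).
  rewrite -RintegralZl// (_ : 2 * I1 = I1 - I2); last by rewrite I21; ring.
  rewrite -RintegralB//; apply: eq_Rintegral => y _; rewrite /k; ring.
have k_ge0 y : 0 <= y -> 0 <= k y.
  move=> y0; rewrite kE subr_ge0; apply: heat_kernel0_le.
  rewrite [`|y + x1|]ger0_norm ?addr_ge0 ?(ltW x10)// ler_norml.
  by apply/andP; split; lra.
have S_ge0 y : 0 <= y -> 0 <= S y.
  by move=> y0; apply: step_ge0; rewrite mulr_ge0 ?sqrtr_ge0.
have kS_ge0 y : 0 <= k y * S y.
  have [y0|y0] := leP 0 y; first by rewrite mulr_ge0 ?k_ge0 ?S_ge0.
  have kN : k y = - k (- y).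
    rewrite !kE opprB -(heat_kernel0_even (- y - x1)) -(heat_kernel0_even (- y + x1)).
    by congr (heat_kernel 0 _ - heat_kernel 0 _); ring.
  have SN : S y = - S (- y).
    by have := S_odd (- y); rewrite opprK -mulrN => /(mulfI m0).
  by rewrite kN SN mulrNN mulr_ge0 ?k_ge0 ?S_ge0// oppr_ge0 ltW.
have ax : 2 <= a * x1 by rewrite /a mulrAC ler_pdivlMr// ler_pM2l.
have h1 := heat_kernel0_half a0 x10 ax.
have hk0 := heat_kernel0_gt0 a.
have x1a : x1 <= a.
  rewrite /a ler_pdivlMr//; have := rho_sqrt_lt1 rho_gt0 hc; have : x1 * Num.sqrt c <= rho * Num.sqrt c.
    by rewrite ler_pM2r// ltW.
  lra.
have kS_ge y : a < y <= a + x1 -> heat_kernel 0 a <= k y * S y.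
  move=> /andP[ay yax].
  have S2 : 2 <= S y.
    by apply: step_ge2; rewrite mulrC -ltr_pdivrMr.
  have k1 : heat_kernel 0 a / 2 <= k y.
    rewrite kE.
    have : heat_kernel 0 a <= heat_kernel 0 (y - x1).
      by apply: heat_kernel0_le; rewrite [`|a|]gtr0_norm// ler_norml; apply/andP; split; lra.
    have : heat_kernel 0 (y + x1) <= heat_kernel 0 (a + x1).
      by apply: heat_kernel0_le; rewrite !ger0_norm; lra.
    lra.
  by nra.
have := Rintegral_ge_itv (ltW hk0) _ ikS kS_ge0 kS_ge; rewrite lerDl (ltW x10) => /(_ isT).
rewrite addrC addKr => h2.
rewrite -/a -mulrA [x1 * _]mulrC.
apply: (@le_trans _ _ (`|m| * \int[mu]_y (k y * S y))); first by rewrite ler_wpM2l.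
have i0 : 0 <= \int[mu]_y (k y * S y) by apply: le_trans h2; rewrite mulr_ge0// ltW.
by rewrite -[X in _ * X](ger0_norm i0) -normrM -e2 normrM ger0_norm// ler_pM2l.
Qed.

End FixedRatio.

End Optimality.

(** * The estimate and its optimality *)

Section Estimates.
Context {R : realType}.

(** The term of order 0 suffices: optimality for every k is thereby a matter of the supremum
    norm. *)
Lemma Ck_norm_ge k (a : R) (d : R -> R) x : x \in `]0, a[ -> (`|d x|%:E <= Ck_norm k a d)%E.
Proof.
move=> xa; rewrite /Ck_norm big_ord_recl/=.
apply: (@le_trans _ _ (ereal_sup [set `|derive1n 0 d y|%:E | y in `]0%R, a[])).
  by apply: ereal_sup_ubound; exists x.
rewrite leeDl//; apply: sume_ge0 => j _.
apply: (@le_trans _ _ `|derive1n (lift ord0 j) d x|%:E); first by rewrite lee_fin.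
by apply: ereal_sup_ubound; exists x.
Qed.

Lemma upper_estimate (R0 rho : R) (R0_gt0 : 0 < R0) (rho_gt0 : 0 < rho) (eps : R) : 0 < eps < 1 ->
  exists L0 : R, forall (k : nat) (N : R),
  exists2 C : R, 0 < C &
    forall (u0 : R -> R) (L : R) (uL uinf : R -> R -> R) (c : R),
      L1_datum R0 u0 -> L1_norm u0 = N ->
      L0 <= L -> R0 <= L ->
      HC_interval u0 L uL -> HC_halfline u0 uinf ->
      0 < c < 1 / rho ^+ 2 ->
      let t := c * L ^+ 2 in
      let d := fun xi => rescaled uL t xi - rescaled uinf t xi in
      in_Ck k rho d /\
      (Ck_norm k rho d <= (C * expR (- ((1 - eps) / c)))%:E)%E.
Proof.
(* This threshold gives R0 / L <= eps / 4, and R0 < L because eps < 1. *)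
move=> he; have /andP[e0 e1] := he; exists (4 * R0 / eps) => k N.
have e4 : 0 < eps / 4 by rewrite divr_gt0.
have e42 : 2 * (eps / 4) <= 1 by lra.
(* The order k + 1 occurs because w_x / w already contains one derivative. *)
have [C C0 hC] := conv_bound_upto k.+1 rho e4 e42.
pose Q := quotient_bound k (1 + C * growth_bound N rho) (expR (- N)) *
  (C * growth_bound N rho * expR (rho ^+ 2 / eps)).
have G0 : 0 <= growth_bound N rho.
  by rewrite mulr_ge0 ?expR_ge0// addr_ge0// invr_ge0 ltW.
have Q0 : 0 <= Q.
  have CG : 0 <= C * growth_bound N rho by rewrite mulr_ge0// ltW.
  rewrite mulr_ge0//; first by rewrite quotient_bound_ge0 ?addr_ge0 ?expR_gt0.
  by rewrite mulr_ge0// expR_ge0.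
(* [Ck_norm] has k + 1 terms; the summand 1 makes the constant positive. *)
exists (k.+1%:R * Q + 1); first by rewrite ltr_wpDl// mulr_ge0.
move=> u0 L uL uinf c hu0 hN L0L _ [wL hwL ->] [winf hwinf ->] hc t d.
have R0L : R0 < L.
  apply: lt_le_trans L0L; rewrite ltr_pdivlMr//; nra.
have hr : R0 / L <= eps / 4.
  rewrite ler_pdivrMr ?(lt_trans _ R0L)//.
  by move: L0L; rewrite ler_pdivrMr//; lra.
have [f df hf] := rescaled_difference_bounded R0_gt0 rho_gt0 hu0 R0L hwL hwinf hc he hr C0 hC.
split; first exact: (Ck_bounded_in_Ck hf df).
apply: (le_trans (Ck_bounded_Ck_norm hf df)); rewrite lee_fin hN.
have E0 := expR_gt0 (- ((1 - eps) / c)).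
rewrite (_ : k.+1%:R * _ = k.+1%:R * Q * expR (- ((1 - eps) / c))); last by rewrite /Q; ring.
by rewrite ler_pM2r// lerDl.
Qed.

Lemma optimality (R0 rho : R) (R0_gt0 : 0 < R0) (rho_gt0 : 0 < rho)
    (u0 : R -> R) (uL : R -> R -> R -> R) (uinf : R -> R -> R) :
  L1_datum R0 u0 -> mass u0 != 0 ->
  (forall L : R, R0 <= L -> HC_interval u0 L (uL L)) ->
  HC_halfline u0 uinf ->
  forall (k : nat) (beta : R), 1 < beta ->
  ~ exists C L0 : R, 0 < C /\
      forall L c : R, L0 <= L -> R0 <= L -> 0 < c < 1 / rho ^+ 2 ->
      let t := c * L ^+ 2 in
      let d := fun xi => rescaled (uL L) t xi - rescaled uinf t xi in
      (Ck_norm k rho d <= (C * expR (- (beta / c)))%:E)%E.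
Proof.
move=> hu0 M0 hL [winf hinf ->] k beta b1 [C [L0 [C0 hCk]]].
have d4 : 0 < 4^-1 :> R by rewrite invr_gt0.
have [Cg Cg0 hCg] := conv_bound 0 rho d4.
pose G := growth_bound (L1_norm u0) rho.
have G0 : 0 < G by exact: growth_bound_gt0.
pose K := 1 + Cg * G.
have K0 : 0 < K by rewrite addr_gt0// mulr_gt0.
have KB (F : R -> R) : continuous F -> (forall y, `|F y| <= G * (1 + `|y|)) ->
    forall x, 0 <= x <= rho -> `|1 + conv 0 F x 1| <= K.
  move=> cF FB x /andP[x0 xr]; rewrite (le_trans (ler_normD _ _))// normr1 lerD2l.
  have := hCg F G 0 cF FB (lexx 0) (fun x y _ _ => normr_ge0 _) _ x.
  rewrite expr0n/= mul0r mulr0 oppr0 expR0 mulr1; apply; first by lra.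
  by rewrite ger0_norm.
pose x1 := rho / 2.
have x10 : 0 < x1 by rewrite divr_gt0.
have x1r : 0 < x1 < rho by rewrite x10 /x1; lra.
pose m := expR (mass u0) - 1.
have m0 : 0 < `|m| by rewrite normr_gt0 subr_eq0 -expR0; apply: contra_neq M0 => /expR_inj.
pose A := 2 * (K * (K * expR (L1_norm u0) * C * x1)).
have A0 : 0 < A by rewrite !mulr_gt0 ?expR_gt0.
pose P := `|m| * x1 * normal_peak (Num.sqrt 2 : R).
have P0 : 0 < P.
  by rewrite !mulr_gt0// normal_peak_gt0// gt_eqF ?sqrtr_gt0.
(* At fixed c, the supposed estimate for all L n and the lower bound for their limit leave an
   inequality in c alone; [A] and [P] do not depend on c. *)
have main c : 0 < c < 1 / rho ^+ 2 -> Num.sqrt c <= x1 -> P * expR ((beta - 1) / c) <= A.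
  move=> hc cx; have /andP[c0 _] := hc.
  pose L (n : nat) : R := n%:R + (`|L0| + R0 + 1).
  have LR n : R0 < L n by rewrite /L; have := ler0n R n; have := normr_ge0 L0; lra.
  have LL n : L0 <= L n.
    by rewrite /L; have := ler0n R n; have := ler_norm L0; have := R0_gt0; lra.
  have Loo : L @ \oo --> +oo.
    by apply/cvgryPge => B; near=> n; rewrite /L -lerBlDr; near: n; exact: nbhs_infty_ger.
  have hD n : `|conv 0 (scaled_difference u0 (L n) c) x1 1| <=
      K * (K * expR (L1_norm u0) * (C * expR (- (beta / c))) * x1).
    have [wL hwL wLE] := hL (L n) (ltW (LR n)).
    apply: (conv_difference_le R0_gt0 rho_gt0 hu0 (LR n) hwL hinf hc x1r).
    - apply: KB; first exact: (continuous_scaled_datum hinf).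
      by move=> y; exact: (scaled_datum_growth _ _ rho_gt0 hu0).
    - apply: KB; first exact: (continuous_scaled_interval_datum R0_gt0 hu0 (LR n) hinf).
      by move=> y; exact: (scaled_interval_datum_growth R0_gt0 rho_gt0 hu0 (LR n) hc).
    - move=> x xr; rewrite -lee_fin; apply: le_trans (hCk _ c (LL n) (ltW (LR n)) hc).
      by rewrite wLE; apply: Ck_norm_ge.
  have := limit_difference_ge R0_gt0 rho_gt0 hu0 hinf hc LR Loo x1r cx hD.
  rewrite -/m /heat_kernel/= hornerC => h.
  have e1 : (2 / Num.sqrt c) ^+ 2 / 4 = c^-1.
    by rewrite expr_div_n sqr_sqrtr ?(ltW c0)//; field; rewrite gt_eqF.
  rewrite e1 in h.
  have e2 : expR ((beta - 1) / c) = expR (- c^-1) * expR (beta / c).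
    by rewrite -expRD; congr expR; field; rewrite gt_eqF.
  have e3 : expR (- (beta / c)) * expR (beta / c) = 1 by rewrite -expRD addNr expR0.
  have E0 := expR_gt0 (beta / c).
  rewrite -(ler_pM2r E0) in h.
  rewrite e2 (_ : P * _ = `|m| * x1 * (normal_peak (Num.sqrt 2) * expR (- c^-1)) * expR (beta / c)); last by rewrite /P; ring.
  apply: (le_trans h).
  rewrite [leLHS](_ : _ = A * (expR (- (beta / c)) * expR (beta / c))); last by rewrite /A; ring.
  by rewrite e3 mulr1.
(* The three terms make c admissible, give sqrt c <= x1, and give (beta - 1) / c >= A / P, which
   contradicts [main] because e^y >= 1 + y. *)
pose c := Num.min (Num.min (2^-1 / rho ^+ 2) (x1 ^+ 2)) ((beta - 1) / (A / P)).
have r2 : 0 < rho ^+ 2 by rewrite exprn_gt0.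
have AP : 0 < A / P by rewrite divr_gt0.
have b0 : 0 < beta - 1 by rewrite subr_gt0.
have c0 : 0 < c.
  rewrite !lt_min; apply/andP; split; last exact: divr_gt0.
  by apply/andP; split; [rewrite divr_gt0// invr_gt0|rewrite exprn_gt0].
have c1 : c <= 2^-1 / rho ^+ 2 by rewrite !ge_min lexx.
have c2 : c <= x1 ^+ 2 by rewrite !ge_min lexx orbT.
have c3 : c <= (beta - 1) / (A / P) by rewrite !ge_min lexx !orbT.
have hc : 0 < c < 1 / rho ^+ 2.
  by rewrite c0 (le_lt_trans c1)// ltr_pM2r ?invr_gt0//; lra.
have cx : Num.sqrt c <= x1.
  by rewrite -(ger0_norm (ltW x10)) -sqrtr_sqr ler_wsqrtr.
have := main c hc cx; rewrite leNgt => /negP; apply.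
rewrite mulrC -ltr_pdivrMr//.
have h1 : A / P <= (beta - 1) / c.
  by rewrite ler_pdivlMr// mulrC -ler_pdivlMr.
by rewrite (le_lt_trans h1)// (lt_le_trans _ (expR_ge1Dx _))// ltrDr.
Unshelve.
all: end_near.
Qed.

End Estimates.

Theorem theorem3p15 (R : realType) (R0 rho : R)
    (R0_gt0 : 0 < R0) (rho_gt0 : 0 < rho) :
  (forall eps : R, 0 < eps < 1 ->
    exists L0 : R, forall (k : nat) (N : R),
    exists2 C : R, 0 < C &
      forall (u0 : R -> R) (L : R) (uL uinf : R -> R -> R) (c : R),
        L1_datum R0 u0 -> L1_norm u0 = N ->
        L0 <= L -> R0 <= L ->
        HC_interval u0 L uL -> HC_halfline u0 uinf ->
        0 < c < 1 / rho ^+ 2 ->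
        let t := c * L ^+ 2 in
        let d := fun xi => rescaled uL t xi - rescaled uinf t xi in
        in_Ck k rho d /\
        (Ck_norm k rho d <= (C * expR (- ((1 - eps) / c)))%:E)%E) /\
  (forall (u0 : R -> R) (uL : R -> R -> R -> R) (uinf : R -> R -> R),
    L1_datum R0 u0 -> mass u0 != 0 ->
    (forall L : R, R0 <= L -> HC_interval u0 L (uL L)) ->
    HC_halfline u0 uinf ->
    forall (k : nat) (beta : R), 1 < beta ->
    ~ exists C L0 : R, 0 < C /\
        forall L c : R, L0 <= L -> R0 <= L -> 0 < c < 1 / rho ^+ 2 ->
        let t := c * L ^+ 2 in
        let d := fun xi => rescaled (uL L) t xi - rescaled uinf t xi in
        (Ck_norm k rho d <= (C * expR (- (beta / c)))%:E)%E).
Proof.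
split; first by move=> eps; exact: upper_estimate.
exact: optimality.
Qed.
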